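(* Let $\mathbf{U}$ and $\mathbf{U}^+$ be universes with $\mathbf{U} \in \mathbf{U}^+$, and let $\kappa$ and $\lambda$ be regular cardinals in $\mathbf{U}$. Suppose that $\mathcal{C}$ is a locally $\kappa$-presentable $\mathbf{U}$-category, $\mathcal{D}$ is a locally $\lambda$-presentable $\mathbf{U}$-category, $\mathcal{C}^+$ is a locally $\kappa$-presentable $\mathbf{U}^+$-category, and $\mathcal{D}^+$ is a locally $\lambda$-presentable $\mathbf{U}^+$-category. Let $F : \mathcal{A} \to \mathcal{C}$ and $G : \mathcal{A} \to \mathcal{D}$ be functors, let $i : \mathcal{C} \to \mathcal{C}^+$ be a $(\kappa,\mathbf{U},\mathbf{U}^+)$-accessible extension, and let $j : \mathcal{D} \to \mathcal{D}^+$ be a $(\lambda,\mathbf{U},\mathbf{U}^+)$-accessible extension. Let $H : \mathcal{C} \to \mathcal{D}$ and $H^+ : \mathcal{C}^+ \to \mathcal{D}^+$ be functors. (i) Assuming $\mathcal{A}$ is $\mathbf{U}'$-small for some pre-universe $\mathbf{U}'$, if $H$ is a pointwise right Kan extension of $G$ along $F$, then $jH$ is a pointwise right Kan extension of $jG$ along $F$; and if $H^+$ is a pointwise right Kan extension of $jH$ along $i$, then $H^+$ is also a pointwise right Kan extension of $jG$ along $iF$. (ii) Assuming $\mathcal{A}$ is $\mathbf{U}$-small, if $H$ is a pointwise left Kan extension of $G$ along $F$, then $jH$ is a pointwise left Kan extension of $jG$ along $F$; and if $H^+$ is a pointwise left Kan extension of $jH$ along $i$, then $H^+$ is also a pointwise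 left Kan extension of $jG$ along $iF$.
   Context: A pre-universe is a set $\mathbf{U}$ such that: if $x \in y$ and $y \in \mathbf{U}$ then $x \in \mathbf{U}$; if $x, y \in \mathbf{U}$ then $\{x,y\} \in \mathbf{U}$; if $x \in \mathbf{U}$ then the power set of $x$ is in $\mathbf{U}$; if $x \in \mathbf{U}$ and $f : x \to \mathbf{U}$ is a map then $\bigcup_{t \in x} f(t) \in \mathbf{U}$. A universe is a pre-universe containing $\omega$ as a member. All categories are sets (models of the theory of categories inside set theory). A category is $\mathbf{U}$-small if its sets of objects and morphisms are members of $\mathbf{U}$; it is locally $\mathbf{U}$-small if its sets of objects and morphisms are subsets of $\mathbf{U}$ and all its hom-sets are members of $\mathbf{U}$. A $\mathbf{U}$-small diagram is a functor from a $\mathbf{U}$-small category. Let $\kappa$ be a regular cardinal in a universe $\mathbf{U}$. An object $A$ of a category $\mathcal{C}$ is $(\kappa,\mathbf{U})$-compact if $\mathrm{Hom}_{\mathcal{C}}(A,-)$, regarded as a functor to a sufficiently large category of sets, preserves colimits of all $\mathbf{U}$-small $\kappa$-filtered diagrams; $\mathbf{K}_\kappa^{\mathbf{U}}(\mathcal{C})$ denotes the full subcategory of $(\kappa,\mathbf{U})$-compact objects. A $\kappa$-accessible $\mathbf{U}$-category is a locally $\mathbf{U}$-small category $\mathcal{C}$ that has colimits for all $\mathbf{U}$-small $\kappa$-filtered diagrams and for which there is a set $\mathcal{G} \in \mathbf{U}$ of $(\kappa,\mathbf{U})$-compact objects such that every object of $\mathcal{C}$ is a colimit of a $\mathbf{U}$-small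 $\kappa$-filtered diagram of objects in $\mathcal{G}$. A locally $\kappa$-presentable $\mathbf{U}$-category is a $\kappa$-accessible $\mathbf{U}$-category having colimits for all $\mathbf{U}$-small diagrams. A $(\kappa,\mathbf{U})$-accessible functor is a functor whose domain is a $\kappa$-accessible $\mathbf{U}$-category and which preserves colimits of all $\mathbf{U}$-small $\kappa$-filtered diagrams. Let $\mathbf{U}^+$ be a universe with $\mathbf{U} \subseteq \mathbf{U}^+$. A $(\kappa,\mathbf{U},\mathbf{U}^+)$-accessible extension is a $(\kappa,\mathbf{U})$-accessible functor $i : \mathcal{C} \to \mathcal{C}^+$ such that $\mathcal{C}$ is a $\kappa$-accessible $\mathbf{U}$-category, $\mathcal{C}^+$ is a $\kappa$-accessible $\mathbf{U}^+$-category, $i$ sends $(\kappa,\mathbf{U})$-compact objects of $\mathcal{C}$ to $(\kappa,\mathbf{U}^+)$-compact objects of $\mathcal{C}^+$, and the induced functor $\mathbf{K}_\kappa^{\mathbf{U}}(\mathcal{C}) \to \mathbf{K}_\kappa^{\mathbf{U}^+}(\mathcal{C}^+)$ is fully faithful and essentially surjective on objects. For functors $F : \mathcal{A} \to \mathcal{C}$ and $G : \mathcal{A} \to \mathcal{D}$, a pointwise right Kan extension of $G$ along $F$ is a functor $H : \mathcal{C} \to \mathcal{D}$ (together with a natural transformation $HF \Rightarrow G$) exhibiting each $H(C)$ as the limit of $G$ weighted by $\mathrm{Hom}_{\mathcal{C}}(C, F-)$, i.e. the induced maps $\mathrm{Hom}_{\mathcal{D}}(D, HC) \to \mathrm{Nat}(\mathrm{Hom}_{\mathcal{C}}(C,F-),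 \mathrm{Hom}_{\mathcal{D}}(D,G-))$ are bijections for all $C$ and $D$. Dually, a pointwise left Kan extension of $G$ along $F$ is a functor $H : \mathcal{C} \to \mathcal{D}$ (together with a natural transformation $G \Rightarrow HF$) such that the induced maps $\mathrm{Hom}_{\mathcal{D}}(HC, D) \to \mathrm{Nat}(\mathrm{Hom}_{\mathcal{C}}(F-,C), \mathrm{Hom}_{\mathcal{D}}(G-,D))$ are bijections for all $C$ and $D$. None of the triangles formed by $F, G, H, i, j, H^+$ is assumed to commute. *)

(* Defs.v *)
(* Set theory is interpreted in the type [V] of well-founded sets (Aczel's
   iterative hierarchy, quotiented by extensional equality).  With the classical
   axioms and the choice operator of [boolp], [V] is a model of ZFC whose
   separation and replacement schemes accept arbitrary Rocq predicates and
   functions. *)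
From mathcomp Require Import ssreflect ssrfun ssrbool.
From mathcomp Require Import boolp.

Set Implicit Arguments.
Unset Strict Implicit.
Unset Printing Implicit Defensive.

Lemma sig_eq (T : Type) (P : T -> Prop) (x y : {z | P z}) :
  proj1_sig x = proj1_sig y -> x = y.
Proof.
case: x y => [x Px] [y Py] /= xy; case: _ / xy Py => Py.
by rewrite (Prop_irrelevance Px Py).
Qed.

Inductive tree : Type := sup (A : Type) (f : A -> tree).

Fixpoint teq (s t : tree) : Prop :=
  match s, t with
  | sup A f, sup B g =>
      (forall a, exists b, teq (f a) (g b)) /\
      (forall b, exists a, teq (f a) (g b))
  end.

Lemma teq_refl t : teq t t.
Proof. by elim: t => A f IH /=; split=> a; exists a. Qed.

Lemma teq_sym s t : teq s t -> teq t s.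
Proof.
elim: s t => A f IH [B g] /= [fg gf]; split.
- by move=> b; have [a /IH] := gf b; exists a.
- by move=> a; have [b /IH] := fg a; exists b.
Qed.

Lemma teq_trans s t r : teq s t -> teq t r -> teq s r.
Proof.
elim: s t r => A f IH [B g] [C h] /= [fg gf] [gh hg]; split.
- move=> a; have [b fab] := fg a; have [c gbc] := gh b.
  by exists c; apply: IH fab gbc.
- move=> c; have [b gbc] := hg c; have [a fab] := gf b.
  by exists a; apply: IH fab gbc.
Qed.

(* The quotient of [tree] by [teq], as the type of its equivalence classes, so
   that equality of sets is Leibniz equality. *)
Definition V : Type := {P : tree -> Prop | exists t, P = teq t}.

Definition class (t : tree) : V :=
  exist (fun P : tree -> Prop => exists t, P = teq t)
    (teq t) (ex_intro (fun u => teq t = teq u) t erefl).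

Definition repr (x : V) : tree := projT1 (cid (proj2_sig x)).

Lemma classP s t : class s = class t <-> teq s t.
Proof.
split=> [[E]|st]; first by rewrite E; exact: teq_refl.
apply: sig_eq; apply/funext => u; apply/propext; split.
- exact/teq_trans/teq_sym.
- exact: teq_trans.
Qed.

Lemma reprK x : class (repr x) = x.
Proof.
by apply: sig_eq; rewrite /repr; case: (cid (proj2_sig x)) => t /= ->.
Qed.

(* The elements of [x] are the [elt i] for [i : idx x]; [idx x] lives in the
   universe of the index types of [tree], contrary to [El x] below. *)
Definition idx (x : V) : Type := match repr x with sup A _ => A end.

Definition elt (x : V) : idx x -> V :=
  match repr x as t return match t with sup A _ => A end -> V with
  | sup A f => fun a => class (f a)
  end.

Definition mem (x y : V) : Prop := exists i : idx y, elt i = x.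

Declare Scope set_scope.
Delimit Scope set_scope with V.
Open Scope set_scope.
Notation "x ∈ y" := (mem x y) (at level 70, no associativity) : set_scope.

Definition subset (x y : V) : Prop := forall z, z ∈ x -> z ∈ y.
Notation "x ⊆ y" := (subset x y) (at level 70, no associativity) : set_scope.

Definition mk (A : Type) (f : A -> V) : V := class (sup (fun a => repr (f a))).

Lemma mem_class (x : V) (t : tree) :
  x ∈ class t <-> match t with sup A f => exists a, class (f a) = x end.
Proof.
rewrite /mem /idx /elt.
have : teq (repr (class t)) t by apply/classP; rewrite reprK.
case: (repr (class t)) => B g; case: t => A f /= [gf fg]; split.
- by case=> b <-; have [a /classP ->] := gf b; exists a.
- by case=> a <-; have [b /classP <-] := fg a; exists b.
Qed.

Lemma mem_mk (A : Type) (f : A -> V) x : x ∈ mk f <-> exists a, f a = x.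
Proof.
by rewrite mem_class; split=> -[a <-]; exists a; rewrite reprK.
Qed.

Lemma set_ext x y : (forall z, z ∈ x <-> z ∈ y) -> x = y.
Proof.
rewrite -(reprK x) -(reprK y).
case: (repr x) => A f; case: (repr y) => B g xy; apply/classP; split.
- move=> a; have /xy : class (f a) ∈ class (sup f) by apply/mem_class; exists a.
  by move=> /mem_class[b /classP/teq_sym]; exists b.
- move=> b; have /xy : class (g b) ∈ class (sup g) by apply/mem_class; exists b.
  by move=> /mem_class[a /classP]; exists a.
Qed.

Definition El (x : V) : Type := {y : V | y ∈ x}.

Definition val (x : V) (a : El x) : V := proj1_sig a.

Lemma val_inj x : injective (@val x).
Proof. by move=> a b; exact: sig_eq. Qed.

Definition el (x : V) (i : idx x) : El x :=
  exist (fun y => y ∈ x) (elt i) (ex_intro _ i erefl).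

Definition pair (x y : V) : V := mk (fun b : bool => if b then x else y).

Lemma mem_pair x y z : z ∈ pair x y <-> z = x \/ z = y.
Proof.
rewrite mem_mk; split; first by case=> -[]; [left|right].
by case=> ->; [exists true|exists false].
Qed.

Definition power (x : V) : V := mk (fun P : idx x -> Prop =>
  mk (fun i : {i : idx x | P i} => elt (proj1_sig i))).

Lemma mem_power x z : z ∈ power x <-> z ⊆ x.
Proof.
rewrite mem_mk; split.
- by case=> P <- y /mem_mk[[i Pi] <-]; exists i.
- move=> zx; exists (fun i => elt i ∈ z); apply: set_ext => y.
  rewrite mem_mk; split; first by case=> -[i iz] <-.
  by move=> yz; have [i iy] := zx _ yz; rewrite -iy in yz *; exists (exist _ i yz).
Qed.

Definition bigcup (x : V) (f : El x -> V) : V :=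
  mk (fun p : {i : idx x & idx (f (el i))} => elt (projT2 p)).

Lemma mem_bigcup x (f : El x -> V) z :
  z ∈ bigcup f <-> exists a : El x, z ∈ f a.
Proof.
rewrite mem_mk; split.
- by case=> -[i k] <-; exists (el i); exists k.
- case=> -[y [i iy]] za; have E : el i = exist _ y (ex_intro _ i iy).
    exact: val_inj.
  by rewrite -E in za; case: za => k <-; exists (existT _ i k).
Qed.

Definition succ (x : V) : V :=
  mk (fun o : option (idx x) => if o is Some i then elt i else x).

Lemma mem_succ x z : z ∈ succ x <-> z ∈ x \/ z = x.
Proof.
rewrite mem_mk; split.
- by case=> -[i|] <-; [left; exists i|right].
- by case=> [[i <-]| ->]; [exists (Some i)|exists None].
Qed.

Fixpoint numeral (n : nat) : V :=
  match n with
  | O => mk (fun v : Empty_set => match v with end)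
  | S m => succ (numeral m)
  end.

Definition omega : V := mk numeral.

Record pre_universe (U : V) : Prop := {
  pre_universe_trans : forall x y, x ∈ y -> y ∈ U -> x ∈ U;
  pre_universe_pair : forall x y, x ∈ U -> y ∈ U -> pair x y ∈ U;
  pre_universe_power : forall x, x ∈ U -> power x ∈ U;
  pre_universe_bigcup : forall (x : V) (f : El x -> El U),
    x ∈ U -> bigcup (fun t => val (f t)) ∈ U
}.

Definition universe (U : V) : Prop := pre_universe U /\ omega ∈ U.

Definition transitive_set (x : V) : Prop := forall y, y ∈ x -> y ⊆ x.

(* Sound by well-foundedness of [V]. *)
Definition ordinal (x : V) : Prop :=
  transitive_set x /\ forall y, y ∈ x -> transitive_set y.

Definition cardinal (k : V) : Prop :=
  ordinal k /\ forall a, a ∈ k -> ~ exists f : El a -> El k, bijective f.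

Definition regular_cardinal (k : V) : Prop :=
  [/\ cardinal k, omega ⊆ k
    & forall a (f : El a -> El k), a ∈ k ->
        exists b : El k, forall t, val (f t) ∈ val b].

Definition card_lt (x k : V) : Prop :=
  exists2 a, a ∈ k & exists f : El x -> El a, injective f.

Declare Scope cat_scope.
Delimit Scope cat_scope with cat.
Open Scope cat_scope.

(* Possibly large categories; the only genuinely large one used below is the
   category [SET] of all sets. *)
Record category := Category {
  obj : Type;
  hom : obj -> obj -> Type;
  idm : forall a, hom a a;
  comp : forall a b c, hom b c -> hom a b -> hom a c;
  comp1m : forall a b (f : hom a b), comp (idm b) f = f;
  compm1 : forall a b (f : hom a b), comp f (idm a) = f;
  compA : forall a b c d (h : hom c d) (g : hom b c) (f : hom a b),
    comp h (comp g f) = comp (comp h g) f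
}.
Arguments hom {_} _ _.
Arguments idm {_} _.
Arguments comp {_ a b c} _ _.
Notation "g ∘ f" := (comp g f) (at level 40, left associativity) : cat_scope.

(* Categories that are sets.  Pairwise disjoint hom-sets amount to a set of
   morphisms [smor] together with domain and codomain functions. *)
Record setcat := SetCat {
  sob : V;
  shom : El sob -> El sob -> V;
  shom_disjoint : forall a b a' b' f,
    f ∈ shom a b -> f ∈ shom a' b' -> a = a' /\ b = b';
  sid : forall a, El (shom a a);
  scomp : forall a b c, El (shom b c) -> El (shom a b) -> El (shom a c);
  scomp1m : forall a b (f : El (shom a b)), scomp (sid b) f = f;
  scompm1 : forall a b (f : El (shom a b)), scomp f (sid a) = f;
  scompA : forall a b c d
      (h : El (shom c d)) (g : El (shom b c)) (f : El (shom a b)),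
    scomp h (scomp g f) = scomp (scomp h g) f
}.
Arguments shom _ _ _ : clear implicits.

Definition smor (C : setcat) : V :=
  bigcup (fun a => bigcup (fun b => shom C a b)).

Coercion category_of (C : setcat) : category :=
  {| obj := El (sob C);
     hom := fun a b => El (shom C a b);
     idm := @sid C;
     comp := @scomp C;
     comp1m := @scomp1m C;
     compm1 := @scompm1 C;
     compA := @scompA C |}.

Definition SET : category :=
  {| obj := V;
     hom := fun x y => El x -> El y;
     idm := fun x a => a;
     comp := fun x y z g f a => g (f a);
     comp1m := fun x y f => erefl;
     compm1 := fun x y f => erefl;
     compA := fun x y z t h g f => erefl |}.

Definition op (C : setcat) : setcat :=
  {| sob := sob C;
     shom := fun a b => shom C b a;
     shom_disjoint := fun a b a' b' f fab fab' =>
       let: conj eb ea := shom_disjoint fab fab' in conj ea eb;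
     sid := fun a => sid a;
     scomp := fun a b c g f => scomp f g;
     scomp1m := fun a b f => scompm1 f;
     scompm1 := fun a b f => scomp1m f;
     scompA := fun a b c d h g f => esym (scompA f g h) |}.

Definition isomorphic (C : category) (a b : obj C) : Prop :=
  exists (f : hom a b) (g : hom b a), g ∘ f = idm a /\ f ∘ g = idm b.

Record functor (C D : category) := Functor {
  fobj :> obj C -> obj D;
  fmap : forall a b, hom a b -> hom (fobj a) (fobj b);
  fmap1 : forall a, fmap (idm a) = idm (fobj a);
  fmapM : forall a b c (g : hom b c) (f : hom a b),
    fmap (g ∘ f) = fmap g ∘ fmap f
}.
Arguments fmap {C D} _ {a b} _.

Definition fcomp (C D E : category) (G : functor D E) (F : functor C D) :
  functor C E.
Proof.
exists (fun a => G (F a)) (fun a b f => fmap G (fmap F f)).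
- by move=> a; rewrite !fmap1.
- by move=> a b c g f; rewrite !fmapM.
Defined.
Notation "G ⊙ F" := (fcomp G F) (at level 40, left associativity) : cat_scope.

Definition fop (C D : setcat) (F : functor C D) : functor (op C) (op D).
Proof.
exists (fobj F : obj (op C) -> obj (op D)) (fun a b f => @fmap C D F b a f).
- by move=> a; exact: (fmap1 F a).
- by move=> a b c g f; exact: (@fmapM C D F).
Defined.

(* Hom_C(x,-).  The contravariant functor Hom_C(-,x) is [homf (op C) x]. *)
Definition homf (C : setcat) (x : obj C) : functor C SET.
Proof.
exists (fun y => shom C x y : obj SET)
       (fun a b (g : @hom C a b) (f : @hom C x a) => g ∘ f : @hom C x b).
- by move=> a; apply/funext => f; exact: scomp1m.
- by move=> a b c g f; apply/funext => h; rewrite /= scompA.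
Defined.

Record nat_trans (C D : category) (F G : functor C D) := NatTrans {
  component :> forall a, hom (F a) (G a);
  naturality : forall a b (f : hom a b),
    component b ∘ fmap F f = fmap G f ∘ component a
}.

Definition fully_faithful (C D : category) (F : functor C D) : Prop :=
  forall a b, bijective (@fmap C D F a b).

Definition essentially_surjective (C D : category) (F : functor C D) : Prop :=
  forall b : obj D, exists a : obj C, isomorphic (F a) b.

Definition fullsub (C : category) (P : obj C -> Prop) : category :=
  {| obj := {a : obj C | P a};
     hom := fun a b => hom (proj1_sig a) (proj1_sig b);
     idm := fun a => idm (proj1_sig a);
     comp := fun a b c g f => g ∘ f;
     comp1m := fun a b f => comp1m f;
     compm1 := fun a b f => compm1 f;
     compA := fun a b c d h g f => compA h g f |}.

Definition fullsub_functor (C D : category) (P : obj C -> Prop)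
    (Q : obj D -> Prop) (F : functor C D) (FPQ : forall a, P a -> Q (F a)) :
    functor (fullsub P) (fullsub Q) :=
  @Functor (fullsub P) (fullsub Q)
    (fun a => exist Q (F (proj1_sig a)) (FPQ _ (proj2_sig a)))
    (fun a b f => fmap F f)
    (fun a => fmap1 F (proj1_sig a))
    (fun a b c g f => fmapM F g f).

Record cocone (J C : category) (X : functor J C) := Cocone {
  apex : obj C;
  leg : forall a, hom (X a) apex;
  leg_natural : forall a b (f : hom a b), leg b ∘ fmap X f = leg a
}.
Arguments leg {J C X} _ _.

Definition is_colimit (J C : category) (X : functor J C) (c : cocone X) : Prop :=
  forall d : cocone X,
    exists! m : hom (apex c) (apex d), forall a, m ∘ leg c a = leg d a.

Definition has_colimit (J C : category) (X : functor J C) : Prop :=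
  exists c : cocone X, is_colimit c.

Definition map_cocone (J C D : category) (F : functor C D) (X : functor J C)
  (c : cocone X) : cocone (F ⊙ X).
Proof.
exists (F (apex c)) (fun a => fmap F (leg c a)).
by move=> a b f; rewrite /= -fmapM leg_natural.
Defined.

Definition preserves_colimit (J C D : category) (F : functor C D)
    (X : functor J C) : Prop :=
  forall c : cocone X, is_colimit c -> is_colimit (map_cocone F c).

Definition small (U : V) (C : setcat) : Prop := sob C ∈ U /\ smor C ∈ U.

Definition locally_small (U : V) (C : setcat) : Prop :=
  [/\ sob C ⊆ U, smor C ⊆ U & forall a b, shom C a b ∈ U].

Definition card_small (kappa : V) (C : setcat) : Prop :=
  card_lt (sob C) kappa /\ card_lt (smor C) kappa.

Definition filtered (kappa : V) (J : setcat) : Prop :=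
  forall (I : setcat) (X : functor I J),
    card_small kappa I -> inhabited (cocone X).

Definition preserves_filtered_colimits (kappa U : V) (C : setcat)
    (D : category) (F : functor C D) : Prop :=
  forall (J : setcat) (X : functor J C),
    small U J -> filtered kappa J -> preserves_colimit F X.

(* [SET], the category of all sets, serves as the sufficiently large category of
   sets in which Hom(a,-) takes its values. *)
Definition compact (kappa U : V) (C : setcat) (a : obj C) : Prop :=
  preserves_filtered_colimits kappa U (homf a).

Definition K (kappa U : V) (C : setcat) : category :=
  fullsub (@compact kappa U C).

Definition accessible (kappa U : V) (C : setcat) : Prop :=
  [/\ locally_small U C,
      (forall (J : setcat) (X : functor J C),
         small U J -> filtered kappa J -> has_colimit X)
    & exists G : V,
      [/\ G ∈ U,
          G ⊆ sob C,
          (forall a : obj C, val a ∈ G -> compact kappa U a)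
        & forall a : obj C,
            exists (J : setcat) (X : functor J C) (c : cocone X),
              [/\ small U J, filtered kappa J,
                  (forall t, val (X t) ∈ G),
                  is_colimit c & apex c = a]]].

Definition locally_presentable (kappa U : V) (C : setcat) : Prop :=
  accessible kappa U C /\
  forall (J : setcat) (X : functor J C), small U J -> has_colimit X.

Definition accessible_functor (kappa U : V) (C D : setcat) (F : functor C D) :
    Prop :=
  accessible kappa U C /\ preserves_filtered_colimits kappa U F.

Definition accessible_extension (kappa U Uplus : V) (C Cplus : setcat)
    (i : functor C Cplus) : Prop :=
  [/\ accessible_functor kappa U i,
      accessible kappa U C,
      accessible kappa Uplus Cplus
    & exists icompact : forall a, compact kappa U a -> compact kappa Uplus (i a),
        let Ki : functor (K kappa U C) (K kappa Uplus Cplus) :=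
          fullsub_functor icompact in
        fully_faithful Ki /\ essentially_surjective Ki].

Section RightKan.
Variables (A C D : setcat) (F : functor A C) (G : functor A D) (H : functor C D).
Variable eps : nat_trans (H ⊙ F) G.

(* Hom_D(d,Hc) -> Nat(Hom_C(c,F-), Hom_D(d,G-)) *)
Definition ran_map (c : obj C) (d : obj D) (h : hom d (H c)) :
  nat_trans (homf c ⊙ F) (homf d ⊙ G).
Proof.
exists (fun a (x : hom c (F a)) => eps a ∘ (fmap H x ∘ h)).
move=> a b f; apply/funext => x.
have E : eps b ∘ (fmap H (fmap F f ∘ x) ∘ h) = fmap G f ∘ (eps a ∘ (fmap H x ∘ h)).
  by rewrite fmapM -compA (compA (eps b)) (naturality eps f) -compA.
exact: E.
Defined.

Definition pointwise_ran : Prop := forall c d, bijective (@ran_map c d).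

End RightKan.

Section LeftKan.
Variables (A C D : setcat) (F : functor A C) (G : functor A D) (H : functor C D).
Variable eta : nat_trans G (H ⊙ F).

(* Hom_D(Hc,d) -> Nat(Hom_C(F-,c), Hom_D(G-,d)) *)
Definition lan_map (c : obj C) (d : obj D) (h : hom (H c) d) :
  nat_trans (homf (C := op C) c ⊙ fop F) (homf (C := op D) d ⊙ fop G).
Proof.
exists (fun a (x : hom (F a) c) => (h ∘ fmap H x) ∘ eta a).
move=> a b f; apply/funext => x; change (@hom C (F a) c) in x.
have E : (h ∘ fmap H (x ∘ @fmap A C F b a f)) ∘ eta b =
         ((h ∘ fmap H x) ∘ eta a) ∘ @fmap A D G b a f.
  by rewrite -!compA (@naturality A D _ _ eta b a f) fmapM -!compA.
exact: E.
Defined.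

Definition pointwise_lan : Prop := forall c d, bijective (@lan_map c d).

End LeftKan.

Section Pasting.
Variables (A C D Cplus Dplus : setcat) (F : functor A C) (G : functor A D).
Variables (i : functor C Cplus) (j : functor D Dplus).
Variables (H : functor C D) (Hplus : functor Cplus Dplus).

Definition ran_whisker (eps : nat_trans (H ⊙ F) G) :
  nat_trans (j ⊙ H ⊙ F) (j ⊙ G).
Proof.
exists (fun a => fmap j (eps a)) => a b f.
have E : fmap j (eps b) ∘ fmap j (fmap H (fmap F f)) =
         fmap j (fmap G f) ∘ fmap j (eps a).
  by rewrite -!fmapM -(naturality eps f).
exact: E.
Defined.

Definition ran_paste (epsplus : nat_trans (Hplus ⊙ i) (j ⊙ H))
  (eps : nat_trans (H ⊙ F) G) : nat_trans (Hplus ⊙ (i ⊙ F)) (j ⊙ G).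
Proof.
exists (fun a => fmap j (eps a) ∘ epsplus (F a)) => a b f.
have E : fmap j (eps b) ∘ epsplus (F b) ∘ fmap Hplus (fmap i (fmap F f)) =
         fmap j (fmap G f) ∘ (fmap j (eps a) ∘ epsplus (F a)).
  have N : epsplus (F b) ∘ fmap Hplus (fmap i (fmap F f)) =
           fmap j (fmap H (fmap F f)) ∘ epsplus (F a).
    exact: naturality epsplus _ _ (fmap F f).
  rewrite -compA N !compA -!fmapM.
  by rewrite -(naturality eps f).
exact: E.
Defined.

Definition lan_whisker (eta : nat_trans G (H ⊙ F)) :
  nat_trans (j ⊙ G) (j ⊙ H ⊙ F).
Proof.
exists (fun a => fmap j (eta a)) => a b f.
have E : fmap j (eta b) ∘ fmap j (fmap G f) =
         fmap j (fmap H (fmap F f)) ∘ fmap j (eta a).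
  by rewrite -!fmapM (naturality eta f).
exact: E.
Defined.

Definition lan_paste (etaplus : nat_trans (j ⊙ H) (Hplus ⊙ i))
  (eta : nat_trans G (H ⊙ F)) : nat_trans (j ⊙ G) (Hplus ⊙ (i ⊙ F)).
Proof.
exists (fun a => etaplus (F a) ∘ fmap j (eta a)) => a b f.
have E : etaplus (F b) ∘ fmap j (eta b) ∘ fmap j (fmap G f) =
         fmap Hplus (fmap i (fmap F f)) ∘ (etaplus (F a) ∘ fmap j (eta a)).
  have N : etaplus (F b) ∘ fmap j (fmap H (fmap F f)) =
           fmap Hplus (fmap i (fmap F f)) ∘ etaplus (F a).
    exact: naturality etaplus _ _ (fmap F f).
  rewrite compA -N -!compA -!fmapM.
  by rewrite (naturality eta f).
exact: E.
Defined.

End Pasting.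

(* Main.v *)
(* Every object of D+ is a colimit of compact objects, all of which come from D,
   and j is fully faithful; hence D is dense in D+ along j, and whatever is the
   limit of a diagram in D, with arbitrary weights, stays so in D+.

   For left Kan extensions the comma category of j over an object e of D+ is
   U-filtered: a U-small family of objects over e is built from U-small many
   compact objects over e, which lie in a U-small lambda-filtered category of
   compact objects over e, and j preserves the colimit of the latter.  So a
   U-small weighted cocone under j(G-) with apex e, and any equation between
   maps out of it, comes from an object of D over e.

   The extension along i is then composed by the Yoneda lemma. *)
From mathcomp Require Import ssreflect ssrfun ssrbool.
From mathcomp Require Import boolp.
Require Import Defs.

Set Implicit Arguments.
Unset Strict Implicit.
Unset Printing Implicit Defensive.

(** One obstacle is that [accessible] and [filtered] speak of categories that are sets, whereas
    comma categories and the shapes of graphs arise as types. Smallness therefore means an injection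
    of a type into a member of [k], with [k] a regular cardinal or a universe; filteredness is
    restated for graphs, which need no composition law; and [realize] leads back to sets.

    The U-small filtered subcategory of the comma category comes from a transfinite iteration of
    length lambda, which adds an apex for every graph on the objects found so far. Regularity puts
    each lambda-small graph on the union inside a single step, and membership of lambda in U keeps
    the union U-small.

    Uniqueness in (ii) comes from the same lifting as existence: two competing maps are adjoined to
    the weighted cocone and lifted along with it. *)

Lemma bijectiveP (A B : Type) (f : A -> B) :
  bijective f <-> (injective f /\ forall b, exists a, f a = b).
Proof.
split=> [[g fK gK]|[finj fsurj]].
  by split=> [|b]; [exact: can_inj fK|exists (g b)].
exists (fun b => projT1 (cid (fsurj b))) => x; last exact: projT2 (cid (fsurj x)).
by apply: finj; exact: projT2 (cid (fsurj (f x))).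
Qed.

Lemma existT_inj (A : Type) (P : A -> Type) (a : A) (x y : P a) :
  existT P a x = existT P a y -> x = y.
Proof.
by move=> E; have := projT2_eq E; rewrite (Prop_irrelevance (projT1_eq E) erefl).
Qed.

(** * Well-foundedness, separation and codes *)

Lemma mem_wf : well_founded mem.
Proof.
move=> x; rewrite -(reprK x); elim: (repr x) => A f IH.
by constructor=> y /mem_class[a <-].
Qed.

Lemma mem_irrefl x : ~ x ∈ x.
Proof. by elim/(well_founded_ind mem_wf): x => x IH xx; exact: (IH x xx xx). Qed.

Definition sep (x : V) (P : V -> Prop) : V :=
  mk (fun i : {i : idx x | P (elt i)} => elt (proj1_sig i)).

Lemma mem_sep x P z : z ∈ sep x P <-> z ∈ x /\ P z.
Proof.
rewrite mem_mk; split=> [[[i Pi] <-]|[[i <-] Pz]]; first by split=> //; exists i.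
by exists (exist _ i Pz).
Qed.

Lemma sep_sub x P : sep x P ⊆ x.
Proof. by move=> z /mem_sep[]. Qed.

Definition opair (x y : V) : V := pair (pair x x) (pair x y).

Lemma pair_inj x y z : pair x y = pair x z -> y = z.
Proof.
move=> E.
have yE : y ∈ pair x z by rewrite -E; apply/mem_pair; right.
have zE : z ∈ pair x y by rewrite E; apply/mem_pair; right.
move: yE zE => /mem_pair[]-> // /mem_pair.
by case.
Qed.

Lemma pair_xx x y z : pair x x = pair y z -> x = y.
Proof.
move=> E; have : y ∈ pair x x by rewrite E; apply/mem_pair; left.
by case/mem_pair.
Qed.

Lemma opair_inj x y x' y' : opair x y = opair x' y' -> x = x' /\ y = y'.
Proof.
move=> E; suff xx' : x = x' by split=> //; move: E; rewrite xx' => /pair_inj/pair_inj.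
have : pair x x ∈ opair x' y' by rewrite -E; apply/mem_pair; left.
by case/mem_pair; exact: pair_xx.
Qed.

Definition toEl (x y : V) (yx : y ∈ x) : El x := exist (fun z => z ∈ x) y yx.

Definition bool_code (b : bool) : V := numeral (if b then 1 else 0).

Lemma bool_code_mem b : bool_code b ∈ numeral 2.
Proof. by apply/mem_succ; case: b; [right|left; apply/mem_succ; right]. Qed.

Lemma bool_code_inj : injective bool_code.
Proof.
have N : numeral 0 <> numeral 1.
  by move=> E; apply: (@mem_irrefl (numeral 0)); rewrite [X in _ ∈ X]E; apply/mem_succ; right.
by case=> -[] // /esym.
Qed.

(** One notion for two uses: at a regular cardinal it is [card_lt] extended to types, and at a
    universe it says that the type is in bijection with a member. *)
Definition small_in (k : V) (A : Type) : Prop :=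
  exists2 a, a ∈ k & exists f : A -> El a, injective f.

Lemma small_in_inj k (A B : Type) (f : A -> B) :
  injective f -> small_in k B -> small_in k A.
Proof. by move=> fi [b bk [g gi]]; exists b => //; exists (g \o f); exact: inj_comp. Qed.

Lemma small_in_El k x : x ∈ k -> small_in k (El x).
Proof. by move=> xk; exists x => //; exists id. Qed.

Lemma small_in_sig k (A : Type) (P : A -> Prop) : small_in k A -> small_in k {a | P a}.
Proof. by apply: small_in_inj (@proj1_sig _ _) _ => x y; exact: sig_eq. Qed.

Lemma small_in_cover k (A B : Type) (f : A -> B) (P : B -> Prop) :
  (forall b, P b -> exists a, f a = b) -> small_in k A -> small_in k {b | P b}.
Proof.
move=> fP; pose g (b : {b | P b}) := projT1 (cid (fP _ (proj2_sig b))).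
have gK b : f (g b) = proj1_sig b by exact: projT2 (cid (fP _ (proj2_sig b))).
by apply: (small_in_inj (f := g)) => b b' E; apply: sig_eq; rewrite -!gK E.
Qed.

(** * Smallness *)

Section Regular.
Variables (k : V) (k_regular : regular_cardinal k).

Lemma regular_trans x y : x ∈ y -> y ∈ k -> x ∈ k.
Proof. by case: k_regular => -[[kt _] _] _ _ xy /kt; apply. Qed.

Lemma regular_elt_trans x : x ∈ k -> transitive_set x.
Proof. by case: k_regular => -[[_ kt] _] _ _ /kt. Qed.

(** [ordinal] asks only for transitivity, so comparability comes from a double ∈-induction: members
    of [x] are compared with [y], and [x] with members of [y]. *)
Lemma regular_trichotomy x y : x ∈ k -> y ∈ k -> [\/ x ∈ y, x = y | y ∈ x].
Proof.
move: x y; apply: (well_founded_ind mem_wf) => x IHx.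
apply: (well_founded_ind mem_wf) => y IHy xk yk.
case: (EM (x ∈ y)) => xy; first exact: Or31.
case: (EM (y ∈ x)) => yx; first exact: Or33.
apply: Or32; apply: set_ext => z; split=> [zx|zy].
  have [//|zy|yz] := IHx z zx y (regular_trans zx xk) yk; first by case: yx; rewrite -zy.
  by case: yx; exact: regular_elt_trans xk z zx _ yz.
have [xz|xz|//] := IHy z zy xk (regular_trans zy yk); last by case: xy; rewrite xz.
by case: xy; exact: regular_elt_trans yk z zy _ xz.
Qed.

Lemma regular_max x y : x ∈ k -> y ∈ k -> exists2 z, z ∈ k & x ⊆ z /\ y ⊆ z.
Proof.
move=> xk yk; have [xy|->|yx] := regular_trichotomy xk yk.
- by exists y => //; split=> //; exact: regular_elt_trans yk x xy.
- by exists y => //; split=> z.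
- by exists x => //; split=> //; exact: regular_elt_trans xk y yx.
Qed.

Lemma small_in_bool : small_in k bool.
Proof.
have nk n : numeral n ∈ k.
  by case: k_regular => _ + _; apply; apply/mem_mk; exists n.
exists (numeral 2) => //; exists (fun b => toEl (bool_code_mem b)).
by move=> b b' /(congr1 (@val _)) /bool_code_inj.
Qed.

Lemma regular_bound (A : Type) (f : A -> V) :
  small_in k A -> (forall x, f x ∈ k) -> exists2 b, b ∈ k & forall x, f x ∈ b.
Proof.
case=> a ak [g gi] fk.
(* Regularity bounds maps defined on a member of [k], so [f] is extended along [g], with the
   harmless value [a] off the image. *)
pose h (t : El a) : El k :=
  if pselect (exists x, g x = t) is left e then toEl (fk (projT1 (cid e)))
  else toEl ak.
case: k_regular => _ _ /(_ a h ak)[[b bk] hb]; exists b => // x.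
have := hb (g x); rewrite /h; case: pselect => [e|[]]; last by exists x.
by have -> // : projT1 (cid e) = x; apply: gi; exact: projT2 (cid e).
Qed.

(* A copy of [b] above [a] is found inside [k] by recursion along [b], each
   step being allowed by regularity, which also bounds the result. *)
Lemma small_in_sum (A B : Type) : small_in k A -> small_in k B -> small_in k (A + B).
Proof.
case=> a ak [f fi] sB; have [b bk [g gi]] := sB.
(* Containing [a] keeps the copy of [b] disjoint from [a]; containing all earlier values makes [h]
   strictly increasing, hence injective by trichotomy. *)
pose good (t : V) (r : forall s, s ∈ t -> V) (y : V) :=
  [/\ y ∈ k, a ⊆ y & forall s st, r s st ∈ y].
pose step t r := if pselect (exists y, @good t r y) is left e then projT1 (cid e) else a.
pose h := Fix mem_wf (fun _ => V) step.
have hE t : h t = step t (fun s _ => h s).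
  apply: Fix_eq => x r r' E; congr step.
  by apply: functional_extensionality_dep => s; apply: funext => st; exact: E.
have hP t : t ∈ k -> good t (fun s _ => h s) (h t).
  elim/(well_founded_ind mem_wf): t => t IH tk; rewrite [h t]hE /step.
  case: pselect => [e|[]]; first exact: projT2 (cid e).
  have [c ck hc] : exists2 c, c ∈ k & forall s : El t, h (val s) ∈ c.
    apply: regular_bound; first exact: small_in_El.
    by case=> s st /=; have [] := IH s st (regular_trans st tk).
  have [y yk [cy ay]] := regular_max ck ak.
  by exists y; split=> // s st; apply: cy; exact: (hc (toEl st)).
have gk x : val (g x) ∈ k by exact: regular_trans (proj2_sig (g x)) bk.
have [c ck hc] : exists2 c, c ∈ k & forall x, h (val (g x)) ∈ c.
  by apply: regular_bound => // x; have [] := hP _ (gk x).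
have [y yk [cy ay]] := regular_max ck ak.
pose F (x : A + B) : El y :=
  match x with
  | inl x => toEl (ay _ (proj2_sig (f x)))
  | inr x => toEl (cy _ (hc x))
  end.
have Nah x : ~ h (val (g x)) ∈ a.
  by have [_ ah _] := hP _ (gk x) => /ah; exact: mem_irrefl.
exists y => //; exists F => -[x|x] [x'|x'] /(congr1 (@val _)) /= E.
- by congr inl; apply: fi; exact: val_inj.
- by case: (Nah x'); rewrite -E; exact: (proj2_sig (f x)).
- by case: (Nah x); rewrite E; exact: (proj2_sig (f x')).
- congr inr; apply: gi; apply: val_inj.
  have [xx'|//|xx'] := regular_trichotomy (gk x) (gk x').
  + have [_ _ /(_ _ xx')] := hP _ (gk x'); rewrite E => /mem_irrefl[].
  + have [_ _ /(_ _ xx')] := hP _ (gk x); rewrite E => /mem_irrefl[].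
Qed.

End Regular.

(** * Closure properties of a universe *)

Section Universe.
Variables (U : V) (U_universe : universe U).

Lemma universe_trans x y : x ∈ y -> y ∈ U -> x ∈ U.
Proof. by case: U_universe => Up _; exact: (pre_universe_trans Up). Qed.

Lemma universe_sub x y : x ⊆ y -> y ∈ U -> x ∈ U.
Proof.
case: U_universe => Up _ /mem_power xy yU.
exact: universe_trans xy (pre_universe_power Up yU).
Qed.

Lemma universe_opair x y : x ∈ U -> y ∈ U -> opair x y ∈ U.
Proof. by case: U_universe => Up _ xU yU; do ?apply: pre_universe_pair. Qed.

Lemma universe_bigcup x (f : El x -> V) :
  x ∈ U -> (forall t, f t ∈ U) -> bigcup f ∈ U.
Proof.
case: U_universe => Up _ xU fU.
exact: (pre_universe_bigcup Up (fun t => toEl (fU t)) xU).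
Qed.

(** Replacement, obtained from the union of singletons. *)
Lemma universe_collect x (f : El x -> V) :
  x ∈ U -> (forall t, f t ∈ U) -> exists2 y, y ∈ U & forall t, f t ∈ y.
Proof.
move=> xU fU; exists (bigcup (fun t => pair (f t) (f t))).
  by apply: universe_bigcup => // t; case: U_universe => Up _; exact: pre_universe_pair.
by move=> t; apply/mem_bigcup; exists t; apply/mem_pair; left.
Qed.

Lemma universe_bound (A : Type) (f : A -> V) :
  small_in U A -> (forall x, f x ∈ U) -> exists2 b, b ∈ U & forall x, f x ∈ b.
Proof.
case=> a aU [g gi] fU.
pose h (t : El a) : V :=
  if pselect (exists x, g x = t) is left e then f (projT1 (cid e)) else a.
have [t|b bU hb] := @universe_collect a h aU; first by rewrite /h; case: pselect.
exists b => // x; have := hb (g x); rewrite /h; case: pselect => [e|[]]; last by exists x.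
by have -> // : projT1 (cid e) = x; apply: gi; exact: projT2 (cid e).
Qed.

Lemma small_in_code (A : Type) (c : A -> V) x :
  x ∈ U -> (forall a, c a ∈ x) -> injective c -> small_in U A.
Proof.
move=> xU cx ci; exists x => //; exists (fun a => toEl (cx a)).
by move=> a b /(congr1 (@val _)) /ci.
Qed.

Lemma small_in_sigT (A : Type) (B : A -> Type) :
  small_in U A -> (forall a, small_in U (B a)) -> small_in U {a & B a}.
Proof.
move=> sA sB; have [u uU [f fi]] := sA.
pose w a := s2val (cid2 (sB a)).
have wU a : w a ∈ U by exact: (s2valP (cid2 (sB a))).
have wP a : exists g : B a -> El (w a), injective g by exact: (s2valP' (cid2 (sB a))).
pose g a := projT1 (cid (wP a)).
have gi a : injective (g a) by exact: projT2 (cid (wP a)).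
pose c (p : {a & B a}) := opair (val (f (projT1 p))) (val (g _ (projT2 p))).
(* All codes must lie in one member of [U]: each fibre is bounded, the bounds are bounded in turn,
   and the union of the last bound is taken. *)
have [y yU wy] : exists2 y, y ∈ U &
    forall a, exists2 z, z ∈ y & forall b : B a, c (existT _ a b) ∈ z.
  have H a : exists2 z, z ∈ U & forall b : B a, c (existT _ a b) ∈ z.
    apply: universe_bound => // b; apply: universe_opair.
      exact: universe_trans (proj2_sig (f a)) uU.
    exact: universe_trans (proj2_sig (g a b)) (wU a).
  have [a|y yU zy] := @universe_bound A (fun a => s2val (cid2 (H a))) sA.
    exact: s2valP (cid2 (H a)).
  exists y => // a; exists (s2val (cid2 (H a))) => //.
  exact: s2valP' (cid2 (H a)).
apply: (small_in_code (c := c) (universe_bigcup (f := @val y) yU _)).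
- by case=> z zy; exact: universe_trans zy yU.
- by case=> a b; have [z zy cz] := wy a; apply/mem_bigcup; exists (toEl zy); exact: cz.
- case=> a b [a' b'] /opair_inj[] /= /val_inj /fi aa'; case: _ / aa' b' => b'.
  by move=> /val_inj /gi ->.
Qed.

Lemma small_in_pred (A : Type) : small_in U A -> small_in U (A -> Prop).
Proof.
case=> u uU [f fi].
apply: (@small_in_code _ (fun Q => sep u (fun y => exists2 a, Q a & val (f a) = y)) (power u)).
- by case: U_universe => Up _; exact: pre_universe_power.
- by move=> Q; apply/mem_power; exact: sep_sub.
- move=> Q Q' E; apply: funext => a; apply/propext.
  have H R : R a <-> val (f a) ∈ sep u (fun y => exists2 a, R a & val (f a) = y).
    rewrite mem_sep; split=> [Ra|[_ [a' Ra' /val_inj /fi <- //]]].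
    by split; [exact: (proj2_sig (f a))|exists a].
  by rewrite (H Q) (H Q') E.
Qed.

Lemma small_in_universe_bool : small_in U bool.
Proof.
have nU n : numeral n ∈ U.
  by case: U_universe => _; apply: universe_trans; apply/mem_mk; exists n.
exact: (small_in_code (nU 2) bool_code_mem bool_code_inj).
Qed.

Lemma small_in_universe_sum (A B : Type) :
  small_in U A -> small_in U B -> small_in U (A + B).
Proof.
move=> sA sB.
pose F (b : bool) := if b then A else B.
pose f (x : A + B) : {b & F b} :=
  match x with inl a => existT F true a | inr b => existT F false b end.
apply: (@small_in_inj _ _ _ f).
  by case=> [a|b] [a'|b'] /= E; first [discriminate | rewrite (existT_inj E)].
by apply: small_in_sigT => [|[]] //; exact: small_in_universe_bool.
Qed.

End Universe.

(** * Categories that are sets, and filteredness *)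

Definition mor (T : category) : Type := {a : obj T & {b : obj T & hom a b}}.

Definition to_mor (T : category) (a b : obj T) (f : hom a b) : mor T :=
  existT _ a (existT _ b f).

Lemma to_mor_inj (T : category) (a b : obj T) : injective (@to_mor T a b).
Proof. by move=> f g E; exact: existT_inj (existT_inj E). Qed.

Lemma to_mor_ends (T : category) (a b a' b' : obj T) (f : hom a b) (g : hom a' b') :
  to_mor f = to_mor g -> a = a' /\ b = b'.
Proof. by move=> E; move: (congr1 (fun m : mor T => (projT1 m, projT1 (projT2 m))) E) => -[]. Qed.

(** * Realizing small categories as sets *)

Section Realize.
Variables (T : category) (u w : V).
Variables (fo : obj T -> El u) (fo_inj : injective fo).
Variables (fm : mor T -> El w) (fm_inj : injective fm).

Let ob : V := sep u (fun y => exists a, val (fo a) = y).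

Let ro (a : El ob) : obj T := projT1 (cid (proj2 (proj1 (mem_sep _ _ _) (proj2_sig a)))).

Let roK a : val (fo (ro a)) = val a.
Proof. exact: projT2 (cid (proj2 (proj1 (mem_sep _ _ _) (proj2_sig a)))). Qed.

Let ro_inj : injective ro.
Proof. by move=> a b E; apply: val_inj; rewrite -!roK E. Qed.

Let ro_surj a : exists b, ro b = a.
Proof.
have H : val (fo a) ∈ ob by apply/mem_sep; split; [exact: (proj2_sig (fo a))|exists a].
by exists (toEl H); apply: fo_inj; apply: val_inj; rewrite roK.
Qed.

(** The code is that of [to_mor f], which records both ends, so that distinct hom-sets are disjoint
    as [setcat] demands. *)
Let ho (a b : El ob) : V :=
  sep w (fun y => exists f : hom (ro a) (ro b), val (fm (to_mor f)) = y).

Let dec a b (f : El (ho a b)) : hom (ro a) (ro b) :=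
  projT1 (cid (proj2 (proj1 (mem_sep _ _ _) (proj2_sig f)))).

Let decK a b (f : El (ho a b)) : val (fm (to_mor (dec f))) = val f.
Proof. exact: projT2 (cid (proj2 (proj1 (mem_sep _ _ _) (proj2_sig f)))). Qed.

Let dec_inj a b : injective (@dec a b).
Proof. by move=> f g E; apply: val_inj; rewrite -!decK E. Qed.

Let enc_mem a b (f : hom (ro a) (ro b)) : val (fm (to_mor f)) ∈ ho a b.
Proof. by apply/mem_sep; split; [exact: (proj2_sig (fm (to_mor f)))|exists f]. Qed.

Let enc a b (f : hom (ro a) (ro b)) : El (ho a b) := toEl (enc_mem f).

Let encK a b (f : hom (ro a) (ro b)) : dec (enc f) = f.
Proof. by apply: to_mor_inj; apply: fm_inj; apply: val_inj; rewrite decK. Qed.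

Let ho_disjoint a b a' b' f : f ∈ ho a b -> f ∈ ho a' b' -> a = a' /\ b = b'.
Proof.
move=> /mem_sep[_ [g <-]] /mem_sep[_ [g' /val_inj /fm_inj /to_mor_ends[]]].
by move=> /ro_inj -> /ro_inj ->.
Qed.

Definition realization : setcat.
Proof.
refine (@SetCat ob ho ho_disjoint (fun a => enc (idm (ro a)))
  (fun a b c g f => enc (dec g ∘ dec f)) _ _ _).
- by move=> a b f; apply: dec_inj; rewrite !encK comp1m.
- by move=> a b f; apply: dec_inj; rewrite !encK compm1.
- by move=> a b c d h g f; apply: dec_inj; rewrite !encK compA.
Defined.

Definition realization_functor : functor realization T.
Proof.
refine (@Functor realization T ro (fun a b f => dec f) _ _).
- by move=> a; exact: encK.
- by move=> a b c g f; exact: encK.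
Defined.

Lemma realization_spec :
  [/\ sob realization ⊆ u, smor realization ⊆ w, fully_faithful realization_functor
    & forall a, exists b, realization_functor b = a].
Proof.
split; last exact: ro_surj.
- exact: sep_sub.
- by move=> z /mem_bigcup[a /mem_bigcup[b /mem_sep[]]].
- move=> a b; exists (@enc a b) => f; last exact: encK.
  by apply: dec_inj; rewrite encK.
Qed.

End Realize.

(** This lets hypotheses about set categories apply to categories built as types. Objects are
    reached up to equality, so cocones and filteredness transfer without choosing isomorphisms. *)
Lemma realize (k : V) (T : category) : small_in k (obj T) -> small_in k (mor T) ->
  exists (J : setcat) (P : functor J T),
    [/\ exists2 u, u ∈ k & sob J ⊆ u, exists2 w, w ∈ k & smor J ⊆ w, fully_faithful P
      & forall a, exists b, P b = a].
Proof.
case=> u uk [fo fo_inj] [w wk [fm fm_inj]].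
have [? ? ? ?] := realization_spec fo_inj fm_inj.
exists (realization fo fm_inj), (realization_functor fo fm_inj).
by split=> //; [exists u|exists w].
Qed.

Lemma smorP (C : setcat) (a b : obj C) (f : hom a b) : val f ∈ smor C.
Proof. by apply/mem_bigcup; exists a; apply/mem_bigcup; exists b; exact: (proj2_sig f). Qed.

(** Since hom-sets are disjoint, an element of [smor C] determines its domain and codomain. *)
Lemma small_mor (k : V) (C : setcat) : small_in k (El (smor C)) -> small_in k (mor C).
Proof.
pose f (m : mor C) := toEl (smorP (projT2 (projT2 m))).
apply: (@small_in_inj _ _ _ f) => -[a [b h]] [a' [b' h']] /(congr1 (@val _)) /= E.
have h'ab : val h ∈ shom C a' b' by rewrite E; exact: (proj2_sig h').
have [aa' bb'] := shom_disjoint (proj2_sig h) h'ab.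
case: _ / aa' h' E {h'ab} => h'; case: _ / bb' h' => h' E.
by have -> : h = h' by exact: val_inj.
Qed.

Definition graph_cocone (T : category) (O M : Type) (o : O -> obj T) (s t : M -> O)
    (p : forall m, hom (o (s m)) (o (t m))) : Prop :=
  exists (c : obj T) (l : forall x, hom (o x) c), forall m, l (t m) ∘ p m = l (s m).

(** Makes sense for a category that is not a set, and agrees with [filtered] on a [setcat] when [k]
    is regular. *)
Definition graph_filtered (k : V) (T : category) : Prop :=
  forall (O M : Type) (o : O -> obj T) (s t : M -> O)
    (p : forall m, hom (o (s m)) (o (t m))),
    small_in k O -> small_in k M -> graph_cocone p.

Lemma graph_filtered_filtered k (J : setcat) : graph_filtered k J -> filtered k J.
Proof.
move=> gJ I X [sO sM].
have [||c [l ll]] := gJ _ _ X (fun m : mor I => projT1 m) (fun m => projT1 (projT2 m))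
  (fun m => fmap X (projT2 (projT2 m))).
- by case: sO => a ak [f fi]; exists a => //; exists f.
- by apply: small_mor; case: sM => a ak [f fi]; exists a => //; exists f.
constructor; exists c l => a b f; exact: (ll (to_mor f)).
Qed.

Lemma filtered_transfer k (J : setcat) (T : category) (P : functor J T) :
  fully_faithful P -> (forall a, exists b, P b = a) -> graph_filtered k T ->
  filtered k J.
Proof.
move=> Pff Psurj gT; apply: graph_filtered_filtered => O M o s t p sO sM.
have [c [l ll]] := gT _ _ (fun x => P (o x)) s t (fun m => fmap P (p m)) sO sM.
have [b Pb] := Psurj c; case: _ / Pb l ll => l ll {c}.
have ffi x y := proj1 (proj1 (bijectiveP _) (Pff x y)).
have ffs x y := proj2 (proj1 (bijectiveP _) (Pff x y)).
pose l' x := projT1 (cid (ffs _ _ (l x))).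
have l'E x : fmap P (l' x) = l x by exact: projT2 (cid (ffs _ _ (l x))).
by exists b, l' => m; apply: ffi; rewrite fmapM !l'E.
Qed.

(** The leg at [a] is the leg at a chosen preimage of [a], transported along the equation between
    objects; fullness makes this natural on all of [T]. *)
Lemma cocone_transfer (J T C : category) (P : functor J T) (X : functor T C)
    (c : cocone (X ⊙ P)) :
  (forall a b, forall f : hom (P a) (P b), exists g, fmap P g = f) ->
  (forall a, exists b, P b = a) ->
  exists l : forall a, hom (X a) (apex c),
    (forall a b (f : hom a b), l b ∘ fmap X f = l a) /\
    (forall b, l (P b) = leg c b).
Proof.
case: c => [c l ln] Pfull Psurj /=.
pose cast a a' (E : P a' = a) : hom (X a) c :=
  match E in _ = a0 return hom (X a0) c with erefl => l a' end.
pose iso a a' (E : P a' = a) : hom (P a') a :=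
  match E in _ = a0 return hom (P a') a0 with erefl => idm (P a') end.
exists (fun a => cast a _ (proj2_sig (cid (Psurj a)))); split=> [a b f|b].
  case: (cid (Psurj a)) => a' Ea; case: (cid (Psurj b)) => b' Eb /=.
  case: _ / Ea f => f; case: _ / Eb f => f.
  by have [g <-] := Pfull _ _ f; exact: (ln _ _ g).
(* The chosen preimage [b'] of [P b] may differ from [b]. Fullness lifts the identity to a map from
   [b'] to [b], and naturality along it identifies the two legs. *)
case: (cid (Psurj (P b))) => b' E /=; have [g gE] := Pfull _ _ (iso _ _ E).
have castP a (Ea : P b' = a) (m : hom (X a) c) :
    m ∘ fmap X (iso a b' Ea) = l b' -> cast a b' Ea = m.
  by case: _ / Ea m => m /=; rewrite fmap1 compm1.
by apply: castP; rewrite -gE; exact: ln.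
Qed.

(** * Graphs as diagrams *)

Section Bipartite.
Variables (O M : Type) (s t : M -> O).

Definition bip_hom (x y : M + O) : Type :=
  match x, y with
  | inl m, inl m' => m = m'
  | inr x, inr x' => x = x'
  | inl m, inr x => {b : bool | (if b then s m else t m) = x}
  | inr _, inl _ => Empty_set
  end.

Definition bip_id x : bip_hom x x :=
  match x with inl _ => erefl | inr _ => erefl end.

Definition bip_comp x y z : bip_hom y z -> bip_hom x y -> bip_hom x z :=
  match x, y, z with
  | inl _, inl _, inl _ => fun g f => etrans f g
  | inl _, inl _, inr _ => fun g f => match esym f in _ = m return bip_hom (inl m) _ with
                                      erefl => g end
  | inl _, inr _, inr _ => fun g f => match g with erefl => f end
  | inr _, inr _, inr _ => fun g f => etrans f g
  | _, inr _, inl _ => fun g _ => match g with end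
  | inr _, inl _, _ => fun _ f => match f with end
  end.

(* The free category on the graph on [M + O] having, for each [m], one arrow
   from [m] to [s m] and another one from [m] to [t m].  Hence every graph on
   [O] gives a diagram of this shape, where [m] is sent to the source of [m]. *)
Definition bip : category.
Proof.
refine (@Category (M + O) bip_hom bip_id bip_comp _ _ _).
- by move=> [m|x] [m'|x'] f //; case: _ / f.
- by move=> [m|x] [m'|x'] f //; case: _ / f.
- case=> [m|x] [m'|x'] [n|y] [n'|y'] h g f //;
    try exact: (match f : Empty_set with end);
    try exact: (match g : Empty_set with end);
    try exact: (match h : Empty_set with end).
  + by case: _ / h; case: _ / g.
  + by case: _ / g h => h; case: _ / f h.
  + by case: _ / h; case: _ / f g.
  + by case: _ / h; case: _ / g.
  + by case: _ / h; case: _ / g.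
Defined.

(** No two generating arrows compose, so the morphisms are the identities and two arrows for each
    [m]. *)
Lemma bip_small k : regular_cardinal k -> small_in k O -> small_in k M ->
  small_in k (obj bip) /\ small_in k (mor bip).
Proof.
move=> kreg sO sM; have sMO := small_in_sum kreg sM sO; split=> //.
pose f (x : mor bip) : (M + O) + (M + M) :=
  match x with
  | existT (inl m) (existT (inr _) e) => inr (if proj1_sig e then inl m else inr m)
  | existT x _ => inl x
  end.
pose g (y : (M + O) + (M + M)) : mor bip :=
  match y with
  | inl x => to_mor (idm (x : obj bip))
  | inr (inl m) => @to_mor bip (inl m) (inr (s m)) (exist _ true erefl)
  | inr (inr m) => @to_mor bip (inl m) (inr (t m)) (exist _ false erefl)
  end.
apply: (@small_in_inj _ _ _ f); last exact: (small_in_sum kreg sMO (small_in_sum kreg sM sM)).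
apply: (can_inj (g := g)) => -[[m|x] [[m'|x'] h]].
- by case: _ / h.
- by case: h => -[] E; case: _ / E.
- by case: h.
- by case: _ / h.
Qed.

Section Diagram.
Variables (T : category) (o : O -> obj T).
Variable (p : forall m, hom (o (s m)) (o (t m))).

Let bo (x : M + O) : obj T := match x with inl m => o (s m) | inr x => o x end.

Let bleg m (b : bool) : hom (o (s m)) (o (if b then s m else t m)) :=
  match b with true => idm _ | false => p m end.

Let bm (x y : M + O) : bip_hom x y -> hom (bo x) (bo y) :=
  match x, y with
  | inl m, inl m' => fun E => match E in _ = m0 return hom (o (s m)) (o (s m0)) with
                              erefl => idm _ end
  | inr x, inr x' => fun E => match E in _ = x0 return hom (o x) (o x0) with
                              erefl => idm _ end
  | inl m, inr x => fun e => match proj2_sig e in _ = x0 return hom (o (s m)) (o x0) with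
                              erefl => bleg m (proj1_sig e) end
  | inr _, inl _ => fun e => match e with end
  end.

Definition bip_functor : functor bip T.
Proof.
refine (@Functor bip T bo bm _ _).
- by case.
- case=> [m|x] [m'|x'] [n|y] g f //;
    try exact: (match f : Empty_set with end);
    try exact: (match g : Empty_set with end).
  + by case: _ / g; case: _ / f; exact: esym (comp1m _).
  + by case: _ / f g => g; exact: (esym (compm1 _)).
  + by case: _ / g; exact: (esym (comp1m _)).
  + by case: _ / g; case: _ / f; exact: (esym (comp1m _)).
Defined.

Lemma bip_cocone : cocone bip_functor -> graph_cocone p.
Proof.
case=> c l ln; exists c, (fun x => l (inr x)) => m.
have := ln (inl m) (inr (s m)) (exist _ true erefl); rewrite /= compm1 => ->.
exact: ln (inl m) (inr (t m)) (exist _ false erefl).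
Qed.

End Diagram.
End Bipartite.

(** The shape [bip] of the graph is realized as a set category of size less than [k]; a cocone on
    the realization extends to [bip] and restricts to the graph. *)
Lemma filtered_graph_filtered k (J : setcat) : regular_cardinal k ->
  filtered k J -> graph_filtered k J.
Proof.
move=> kreg fJ O M o s t p sO sM.
have [sob_ smor_] := bip_small s t kreg sO sM.
have [I [P [[u uk Iu] [w wk Iw] Pff Psurj]]] := realize sob_ smor_.
have incl (x y : V) : x ⊆ y -> exists f : El x -> El y, injective f.
  move=> xy; exists (fun a => toEl (xy _ (proj2_sig a))) => a b /(congr1 (@val _)) /= E.
  exact: val_inj.
have [] := fJ I (bip_functor p ⊙ P); first by split; [exists u|exists w] => //; exact: incl.
move=> c; have [|//|l [ln _]] := @cocone_transfer I (bip s t) J P (bip_functor p) c.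
  by move=> a b; exact: (proj2 (proj1 (bijectiveP _) (Pff a b))).
exact: (bip_cocone (Cocone ln)).
Qed.

Section GraphFiltered.
Variables (k : V) (k_regular : regular_cardinal k) (T : category).
Variable (T_filtered : graph_filtered k T).

Let small_unit : small_in k unit.
Proof. by apply: (@small_in_inj _ _ _ (fun=> true)) (small_in_bool k_regular) => -[] []. Qed.

Let small_empty : small_in k Empty_set.
Proof. by apply: (@small_in_inj _ _ _ (fun=> true)) (small_in_bool k_regular) => -[]. Qed.

Lemma graph_filtered_nonempty : exists a : obj T, True.
Proof.
have [a _] := @T_filtered Empty_set Empty_set (fun x => match x with end)
  (fun m => match m with end) (fun m => match m with end) (fun m => match m with end)
  small_empty small_empty.
by exists a.
Qed.

Lemma graph_filtered_span (a b c : obj T) (f : hom a b) (g : hom a c) :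
  exists (r : obj T) (u : hom b r) (v : hom c r), u ∘ f = v ∘ g.
Proof.
pose o (x : unit + bool) : obj T := match x with inl _ => a | inr x => if x then b else c end.
pose p (m : bool) : hom (o (inl tt)) (o (inr m)) :=
  match m with true => f | false => g end.
have [||r [l E]] := @T_filtered _ _ o (fun=> inl tt) (@inr _ _) p.
- exact: small_in_sum small_unit (small_in_bool k_regular).
- exact: small_in_bool.
by exists r, (l (inr true)), (l (inr false)); rewrite (E true) (E false).
Qed.

End GraphFiltered.

(** [numeral 2] is the subobject classifier of [SET]. Mapping a colimit into it describes its
    elements from the universal property alone, without constructing a quotient. *)
Definition truth_value (P : Prop) : El (numeral 2) := toEl (bool_code_mem (asbool P)).

Lemma truth_valueP (P Q : Prop) : truth_value P = truth_value Q <-> (P <-> Q).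
Proof.
split=> [/(congr1 (@val _)) /= /bool_code_inj E|/propext -> //].
by split=> /asboolP; [rewrite E|rewrite -E] => /asboolP.
Qed.

(** * Filtered colimits of sets and compact objects *)

Section SetColimit.
Variables (k : V) (k_regular : regular_cardinal k) (J : category).
Variables (J_filtered : graph_filtered k J) (X : functor J SET) (c : cocone X).
Variable (c_colimit : is_colimit c).

(** Constant truth and membership in the image of some leg agree after every leg, so they are the
    same map to truth values. *)
Lemma set_colimit_surj (z : El (apex c)) : exists a x, leg c a x = z.
Proof.
pose test (P : El (apex c) -> Prop) : El (apex c) -> El (numeral 2) :=
  fun z => truth_value (P z).
pose d : cocone X := @Cocone J SET X (numeral 2) (fun a x => truth_value True)
  (fun a b f => erefl).
have [m [_ m_unique]] := c_colimit d.
have E1 : m = test (fun=> True) by exact: m_unique.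
have : m = test (fun z => exists a x, leg c a x = z).
  apply: m_unique => a; apply/funext => x; apply/truth_valueP.
  by split=> // _; exists a, x.
by rewrite E1 => /(congr1 (@^~ z)) /truth_valueP[H _]; exact: H.
Qed.

(** Whether [y] is identified with [x] further along the diagram defines a cocone into truth values,
    stable under transition maps by filteredness. It is true at [x], hence at every [y] with the
    same image. *)
Lemma set_colimit_eq a b (x : El (X a)) (y : El (X b)) : leg c a x = leg c b y ->
  exists (r : obj J) (f : hom a r) (g : hom b r), fmap X f x = fmap X g y.
Proof.
move=> E.
pose meets b (y : El (X b)) :=
  exists (r : obj J) (f : hom a r) (g : hom b r), fmap X f x = fmap X g y.
have meets_nat b1 b2 (h : hom b1 b2) :
    (fun y => truth_value (meets b2 (fmap X h y))) = (fun y => truth_value (meets b1 y)).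
  apply/funext => z; apply/truth_valueP; split=> -[r [f [g fg]]].
    by exists r, f, (g ∘ h); rewrite fmapM.
  have [r' [u [v uv]]] := graph_filtered_span k_regular J_filtered g h.
  exists r', (u ∘ f), v; rewrite !fmapM /= fg.
  have := congr1 (fun q => q z) (fmapM X u g); rewrite uv fmapM /=.
  by move=> <-.
pose d : cocone X := @Cocone J SET X (numeral 2) (fun b y => truth_value (meets b y)) meets_nat.
have [m [m_leg _]] := c_colimit d.
have := congr1 (fun q => q x) (m_leg a); have := congr1 (fun q => q y) (m_leg b).
rewrite /= E => -> /truth_valueP[_]; apply.
by exists a, (idm a), (idm a).
Qed.
End SetColimit.

Lemma colimit_ext (J C : category) (X : functor J C) (c : cocone X) (b : obj C)
    (f g : hom (apex c) b) :
  is_colimit c -> (forall t, f ∘ leg c t = g ∘ leg c t) -> f = g.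
Proof.
move=> cc fg.
have dn t t' (h : hom t t') : (g ∘ leg c t') ∘ fmap X h = g ∘ leg c t.
  by rewrite -compA leg_natural.
have [m [_ mu]] := cc (Cocone dn).
by rewrite -(mu f fg); exact: mu.
Qed.

Lemma colimit_glue (J C : category) (X : functor J C) (c : cocone X) (b : obj C)
    (f : forall t, hom (X t) b) :
  is_colimit c -> (forall t t' (h : hom t t'), f t' ∘ fmap X h = f t) ->
  exists g : hom (apex c) b, forall t, g ∘ leg c t = f t.
Proof. by move=> cc fn; have [m [? _]] := cc (Cocone fn); exists m. Qed.

Section Compact.
Variables (kappa U : V) (kappa_regular : regular_cardinal kappa) (C : setcat).
Variables (a : obj C) (a_compact : compact kappa U a).
Variables (J : setcat) (X : functor J C) (c : cocone X).
Hypotheses (J_small : small U J) (J_filtered : filtered kappa J) (c_colimit : is_colimit c).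

Lemma compact_factor (f : hom a (apex c)) : exists t (g : hom a (X t)), leg c t ∘ g = f.
Proof. exact: (set_colimit_surj (a_compact J_small J_filtered c_colimit) f). Qed.

Lemma compact_eq s t (g : hom a (X s)) (h : hom a (X t)) : leg c s ∘ g = leg c t ∘ h ->
  exists (r : obj J) (u : hom s r) (v : hom t r), fmap X u ∘ g = fmap X v ∘ h.
Proof.
have gf := filtered_graph_filtered kappa_regular J_filtered.
exact: (set_colimit_eq kappa_regular gf (a_compact J_small J_filtered c_colimit)).
Qed.

End Compact.

(** The generation clause of [accessible] as data, with [a] itself as the apex in place of an
    equation, and with compactness as all that is retained of the generators. *)
Record presentation (kappa U : V) (C : setcat) (a : obj C) := Presentation {
  shape : setcat;
  diagram : functor shape C;
  inj : forall t, hom (diagram t) a;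
  inj_natural : forall t t' (f : hom t t'), inj t' ∘ fmap diagram f = inj t;
  shape_small : small U shape;
  shape_filtered : filtered kappa shape;
  diagram_compact : forall t, compact kappa U (diagram t);
  inj_colimit : is_colimit (Cocone inj_natural)
}.
Arguments inj {kappa U C a} _ _.
Arguments inj_natural {kappa U C a} _ [t t'] _.
Arguments shape_filtered {kappa U C a} _.
Arguments diagram_compact {kappa U C a} _ _.
Arguments inj_colimit {kappa U C a} _.

Lemma accessible_presentation kappa U (C : setcat) (a : obj C) : accessible kappa U C ->
  inhabited (presentation kappa U a).
Proof.
case=> _ _ [G [_ _ Gcompact /(_ a)[J [X [[b l ln] [sJ fJ XG cc <-]]]]]].
by constructor; exists J X l ln => // t; exact: Gcompact.
Qed.

Lemma compact_inj kappa U (C : setcat) (a b : obj C) (p : presentation kappa U a)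
    (f : hom b a) :
  compact kappa U b -> exists t (g : hom b (diagram p t)), inj p t ∘ g = f.
Proof.
move=> cb.
exact: (compact_factor cb (shape_small p) (shape_filtered p) (inj_colimit p) f).
Qed.

Lemma inj_ext kappa U (C : setcat) (a b : obj C) (p : presentation kappa U a)
    (f g : hom a b) :
  (forall t, f ∘ inj p t = g ∘ inj p t) -> f = g.
Proof. exact: (colimit_ext (inj_colimit p)). Qed.

Lemma inj_glue kappa U (C : setcat) (a b : obj C) (p : presentation kappa U a)
    (f : forall t, hom (diagram p t) b) :
  (forall t t' (h : hom t t'), f t' ∘ fmap (diagram p) h = f t) ->
  exists g : hom a b, forall t, g ∘ inj p t = f t.
Proof. exact: (colimit_glue (inj_colimit p)). Qed.

Definition isomorphism (C : category) (a b : obj C) (f : hom a b) (g : hom b a) : Prop :=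
  g ∘ f = idm a /\ f ∘ g = idm b.

(** * Small filtered subcategories *)

Section Closure.
Variables (k U : V) (k_regular : regular_cardinal k) (U_universe : universe U) (kU : k ∈ U).
Variables (T : category) (T_filtered : graph_filtered k T).
Hypothesis hom_small : forall a b : obj T, small_in U (hom a b).
Variables (B : obj T -> Prop) (B_small : small_in U {a | B a}).

Definition is_graph_apex (O : obj T -> Prop) (M : mor T -> Prop) (c : obj T) : Prop :=
  exists l : forall a, O a -> hom a c, forall (m : mor T)
    (sm : O (projT1 m)) (tm : O (projT1 (projT2 m))),
    M m -> l _ tm ∘ projT2 (projT2 m) = l _ sm.

(** The choice depends only on the two predicates, so a U-small set of objects acquires U-small many
    apexes. A graph without a cocone gets an arbitrary object, which lets [stage_step] admit graphs
    of any size. *)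
Definition graph_apex (O : obj T -> Prop) (M : mor T -> Prop) : obj T :=
  if pselect (exists c, is_graph_apex O M c) is left e then projT1 (cid e)
  else projT1 (cid (graph_filtered_nonempty k_regular T_filtered)).

Lemma graph_apexP O M c : is_graph_apex O M c -> is_graph_apex O M (graph_apex O M).
Proof.
move=> Mc; rewrite /graph_apex; case: pselect => [e|[]]; last by exists c.
exact: projT2 (cid e).
Qed.

(* [stage x], for [x] in [k], is the [x]-th step of the transfinite iteration
   that adds to a set of objects an graph_apex of each graph on it. *)
Inductive stage : V -> obj T -> Prop :=
| stage_base x a : B a -> stage x a
| stage_step x y (O : obj T -> Prop) (M : mor T -> Prop) :
    y ∈ x -> (forall a, O a -> stage y a) ->
    (forall m, M m -> O (projT1 m) /\ O (projT1 (projT2 m))) -> stage x (graph_apex O M).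

Lemma stage_inv x a : stage x a -> B a \/ exists y O M,
  [/\ y ∈ x, forall b, O b -> stage y b,
    forall m, M m -> O (projT1 m) /\ O (projT1 (projT2 m)) & a = graph_apex O M].
Proof. by case=> [x' b|x' y O M]; [left|right; exists y, O, M]. Qed.

Lemma stage_mono x y a : x ∈ k -> y ∈ x -> stage y a -> stage x a.
Proof.
move=> xk yx /stage_inv[|[z [O [M [zy Oz MO ->]]]]]; first exact: stage_base.
by apply: stage_step Oz MO; exact: (regular_elt_trans k_regular xk yx).
Qed.

Lemma fullsub_mor_small (P : obj T -> Prop) : small_in U {a | P a} ->
  small_in U {m : mor T | P (projT1 m) /\ P (projT1 (projT2 m))}.
Proof.
move=> sP; pose S := {a : {a | P a} & {b : {b | P b} & hom (proj1_sig a) (proj1_sig b)}}.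
pose f (x : S) : mor T := to_mor (projT2 (projT2 x)).
apply: (@small_in_cover _ S _ f).
  by case=> a [b h] [/= Pa Pb]; exists (existT _ (exist _ a Pa) (existT _ (exist _ b Pb) h)).
by do 2!apply: (small_in_sigT U_universe) => // ?.
Qed.

(** Beyond [B], an object of stage [x] is determined by some [y] in [x] and two predicates on the
    objects and morphisms of stage [y], which are U-small by induction. *)
Lemma stage_small x : x ∈ U -> small_in U {a | stage x a}.
Proof.
elim/(well_founded_ind mem_wf): x => x IH xU.
pose S y := {a | stage y a}.
pose R y := {m : mor T | stage y (projT1 m) /\ stage y (projT1 (projT2 m))}.
pose X : Type := {a | B a} +
  {y : El x & {_ : S (val y) -> Prop & R (val y) -> Prop}}.
pose f (z : X) : obj T :=
  match z with
  | inl a => proj1_sig a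
  | inr (existT y (existT Q M)) =>
      graph_apex (fun a => exists h : stage (val y) a, Q (exist _ a h))
        (fun m => exists h, M (exist _ m h))
  end.
apply: (@small_in_cover _ X _ f) => [a xa|].
  have [Ba|[y [O [M [yx Oy MO ->]]]]] := stage_inv xa; first by exists (inl (exist _ a Ba)).
  (* [O] and [M] live on stage [y], so restricting them and extending back gives the same
     predicates, hence the same apex. *)
  exists (inr (existT _ (toEl yx) (existT _ (fun a => O (proj1_sig a))
    (fun m => M (proj1_sig m))))) => /=; congr graph_apex; apply/funext => z; apply/propext.
    by split=> [[h Oz]|Oz]; [exact: Oz|exists (Oy _ Oz)].
  split=> [[h Mz]|Mz]; first exact: Mz.
  by have [/Oy s1 /Oy s2] := MO _ Mz; exists (conj s1 s2).
apply: (small_in_universe_sum U_universe) => //.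
apply: (small_in_sigT U_universe); first exact: small_in_El.
case=> y yx; have yU := universe_trans U_universe yx xU.
have sS : small_in U (S y) by exact: IH.
by apply: (small_in_sigT U_universe) => [|_]; apply: (small_in_pred U_universe) => //; exact: fullsub_mor_small.
Qed.

Lemma filtered_closure : exists P : obj T -> Prop,
  [/\ forall a, B a -> P a, small_in U {a | P a} & graph_filtered k (fullsub P)].
Proof.
exists (fun a => exists2 x, x ∈ k & stage x a); split.
(* [B] lies in every stage, so any member of [k] will do; bounding two numerals supplies one. *)
- move=> a Ba; have [x xk _] : exists2 x, x ∈ k & forall b, bool_code b ∈ x.
    apply: (regular_bound k_regular (small_in_bool k_regular)) => b.
    by case: k_regular => _ + _; apply; apply/mem_mk; case: b; [exists 1|exists 0].
  by exists x => //; exact: stage_base.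
- pose S := {x : El k & {a | stage (val x) a}}.
  apply: (@small_in_cover _ S _ (fun x => proj1_sig (projT2 x))).
    by move=> a [x xk xa]; exists (existT _ (toEl xk) (exist _ a xa)).
  apply: (small_in_sigT U_universe); first exact: small_in_El.
  case=> x xk; apply: stage_small.
  exact: (universe_trans U_universe xk kU).
move=> O M o s t p sO sM.
(* The family may repeat objects, while stages see only predicates; the graph is replaced by its
   image, which is again k-small. *)
pose O' a := exists x, proj1_sig (o x) = a.
pose M' m := exists x, @to_mor T (proj1_sig (o (s x))) (proj1_sig (o (t x))) (p x) = m.
have M'O' m : M' m -> O' (projT1 m) /\ O' (projT1 (projT2 m)).
  by case=> x <-; split; [exists (s x)|exists (t x)].
have [x xk Ox] : exists2 x, x ∈ k & forall a, O' a -> stage x a.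
  pose f z := s2val (cid2 (proj2_sig (o z))).
  have fk z : f z ∈ k by exact: s2valP (cid2 (proj2_sig (o z))).
  have fP z : stage (f z) (proj1_sig (o z)) by exact: s2valP' (cid2 (proj2_sig (o z))).
  have [x xk fx] := regular_bound k_regular sO fk.
  by exists x => // a [z <-]; exact: stage_mono xk (fx z) (fP z).
have [l lP] : is_graph_apex O' M' (graph_apex O' M').
  have sO' : small_in k {a | O' a} by exact: (small_in_cover (f := fun x => proj1_sig (o x))).
  have sM' : small_in k {m | M' m} by exact: (small_in_cover (f := fun x => @to_mor T _ _ (p x))).
  pose s' (m : {m | M' m}) : {a | O' a} := exist _ _ (proj1 (M'O' _ (proj2_sig m))).
  pose t' (m : {m | M' m}) : {a | O' a} := exist _ _ (proj2 (M'O' _ (proj2_sig m))).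
  have [c [l lP]] := @T_filtered _ _ (fun a : {a | O' a} => proj1_sig a) s' t'
    (fun m => projT2 (projT2 (proj1_sig m))) sO' sM'.
  apply: (@graph_apexP _ _ c); exists (fun a Oa => l (exist _ a Oa)) => m sm tm Mm.
  have := lP (exist _ m Mm); rewrite /s' /t' /=.
  by rewrite (Prop_irrelevance sm (proj1 (M'O' _ Mm))) (Prop_irrelevance tm (proj2 (M'O' _ Mm))).
(* The apex of a graph on stage [x] appears at a later stage; bounding a constant family gives a
   member of [k] above [x]. *)
have [y yk xy] : exists2 y, y ∈ k & bool -> x ∈ y.
  exact: (regular_bound k_regular (small_in_bool k_regular) (fun=> xk)).
have graph_apexP' : exists2 x, x ∈ k & stage x (graph_apex O' M').
  by exists y => //; exact: stage_step (xy true) Ox M'O'.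
exists (exist (fun a => exists2 x, x ∈ k & stage x a) _ graph_apexP'), (fun z => l _ (ex_intro _ z erefl)) => m /=.
by apply: (lP (@to_mor T _ _ (p m))); exists m.
Qed.

End Closure.

(** * Accessible extensions *)

Section Extension.
Variables (kappa U Uplus : V).
Hypotheses (kappa_regular : regular_cardinal kappa) (kappa_U : kappa ∈ U).
Hypotheses (U_universe : universe U) (Uplus_universe : universe Uplus) (U_Uplus : U ∈ Uplus).
Variables (C Cplus : setcat) (i : functor C Cplus).
Hypothesis (i_ext : accessible_extension kappa U Uplus i).

Lemma small_Uplus J : small U J -> small Uplus J.
Proof. by case=> oU mU; split; apply: (universe_trans Uplus_universe) U_Uplus. Qed.

Let i_preserves : preserves_filtered_colimits kappa U i.
Proof. by case: i_ext => -[]. Qed.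

Let i_compact a : compact kappa U a -> compact kappa Uplus (i a).
Proof. by case: i_ext => _ _ _ [ic _]; exact: ic. Qed.

Let i_compact_bij a b : compact kappa U a -> compact kappa U b -> bijective (@fmap _ _ i a b).
Proof.
move=> ca cb; case: i_ext => _ _ _ [ic [ff _]].
exact: (ff (exist _ a ca) (exist _ b cb)).
Qed.

Let pres (a : obj C) : presentation kappa U a.
Proof.
have [_ C_acc _ _] := i_ext.
by have /cid[p _] : exists p : presentation kappa U a, True
  by case: (accessible_presentation a C_acc) => p; exists p.
Qed.

Lemma compact_lift (b : obj Cplus) : compact kappa Uplus b ->
  exists (a : obj C) (f : hom (i a) b) (g : hom b (i a)),
    compact kappa U a /\ isomorphism f g.
Proof.
move=> cb; case: i_ext => _ _ _ [ic [_ es]].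
have [[a ca] [f [g [gf fg]]]] := es (exist _ b cb).
by exists a, f, g.
Qed.

Let image_colimit (a : obj C) (p : presentation kappa U a) :
  is_colimit (map_cocone i (Cocone (inj_natural p))).
Proof.
exact: (i_preserves (shape_small p) (shape_filtered p) (inj_colimit p)).
Qed.

(** Faithfulness is given only between compact objects. Both maps factor through terms of a
    presentation of [b], and since [i a] is compact, their images already agree at one compact
    term. *)
Let ext_faithful_compact (a b : obj C) (f g : hom a b) : compact kappa U a ->
  fmap i f = fmap i g -> f = g.
Proof.
move=> ca ifg; have p := pres b.
have [s [f' ff']] := compact_inj p f ca; have [t [g' gg']] := compact_inj p g ca.
have E : leg (map_cocone i (Cocone (inj_natural p))) s ∘ fmap i f' =
         leg (map_cocone i (Cocone (inj_natural p))) t ∘ fmap i g'.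
  have E : fmap i (inj p s) ∘ fmap i f' = fmap i (inj p t) ∘ fmap i g'.
    by rewrite -!fmapM ff' gg'.
  exact: E.
have [r [u [v uv]]] := compact_eq kappa_regular (i_compact ca)
  (small_Uplus (shape_small p)) (shape_filtered p) (@image_colimit _ p) E.
have [ii _] := proj1 (bijectiveP _) (i_compact_bij ca (diagram_compact p r)).
have {}uv : fmap (diagram p) u ∘ f' = fmap (diagram p) v ∘ g'.
  by apply: ii; rewrite !fmapM; exact: uv.
by rewrite -ff' -gg' -(inj_natural p u) -(inj_natural p v) -!compA uv.
Qed.

Lemma ext_faithful (a b : obj C) (f g : hom a b) : fmap i f = fmap i g -> f = g.
Proof.
move=> ifg; have p := pres a.
apply: (inj_ext (p := p)) => t.
by apply: ext_faithful_compact; [exact: diagram_compact|rewrite !fmapM ifg].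
Qed.

Let ext_full_compact (a b : obj C) (h : hom (i a) (i b)) : compact kappa U a ->
  exists f, fmap i f = h.
Proof.
move=> ca; have p := pres b.
have [t [g gh]] := compact_factor (i_compact ca) (small_Uplus (shape_small p))
  (shape_filtered p) (@image_colimit _ p) h.
have [_ /(_ g)[f fg]] := proj1 (bijectiveP _) (i_compact_bij ca (diagram_compact p t)).
by exists (inj p t ∘ f); rewrite -gh -fg fmapM.
Qed.

Lemma ext_full (a b : obj C) (h : hom (i a) (i b)) : exists f, fmap i f = h.
Proof.
have p := pres a.
have H t : exists f, fmap i f = h ∘ fmap i (inj p t).
  by apply: ext_full_compact; exact: diagram_compact.
pose k t := projT1 (cid (H t)).
have kE t : fmap i (k t) = h ∘ fmap i (inj p t) by exact: projT2 (cid (H t)).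
have [t t' f|g gE] := inj_glue (f := k).
  by apply: ext_faithful; rewrite fmapM !kE -compA -fmapM inj_natural.
exists g; apply: (colimit_ext (@image_colimit _ p)) => t.
have E : fmap i g ∘ fmap i (inj p t) = h ∘ fmap i (inj p t) by rewrite -fmapM gE kE.
exact: E.
Qed.

Lemma image_ext (a : obj C) (e : obj Cplus) (p : presentation kappa U a)
    (f g : hom (i a) e) :
  (forall t, f ∘ fmap i (inj p t) = g ∘ fmap i (inj p t)) -> f = g.
Proof. exact: (colimit_ext (@image_colimit _ p)). Qed.

Let pres_plus (e : obj Cplus) : presentation kappa Uplus e.
Proof.
have [_ _ Cplus_acc _] := i_ext.
by have /cid[p _] : exists p : presentation kappa Uplus e, True
  by case: (accessible_presentation e Cplus_acc) => p; exists p.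
Qed.

Lemma ext_jointly_epi (e e' : obj Cplus) (f g : hom e e') :
  (forall a (u : hom (i a) e), f ∘ u = g ∘ u) -> f = g.
Proof.
move=> fg; have p := pres_plus e; apply: (inj_ext (p := p)) => t.
have [a [h [h' [_ [_ hh']]]]] := compact_lift (diagram_compact p t).
by rewrite -[inj p t]compm1 -hh' (compA (inj p t)) !compA -!(compA _ (inj p t)) fg.
Qed.

(** The existence half of density, for transformations from [Hom(i -, e)] to [Hom(i -, e')];
    uniqueness is [ext_jointly_epi]. *)
Lemma ext_dense (e e' : obj Cplus) (phi : forall a, hom (i a) e -> hom (i a) e') :
  (forall a b (k : hom a b) (u : hom (i b) e), phi a (u ∘ fmap i k) = phi b u ∘ fmap i k) ->
  exists f : hom e e', forall a u, f ∘ u = phi a u.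
Proof.
move=> phi_nat; have p := pres_plus e.
pose lift t := cid (compact_lift (diagram_compact p t)).
pose d t := projT1 (lift t).
have lift2 t := projT2 (lift t).
pose th t := projT1 (cid (lift2 t)).
pose th' t := projT1 (cid (projT2 (cid (lift2 t)))).
have thP t : compact kappa U (d t) /\ isomorphism (th t) (th' t).
  exact: projT2 (cid (projT2 (cid (lift2 t)))).
have thK t : th' t ∘ th t = idm _ by case: (thP t) => _ [].
have th'K t : th t ∘ th' t = idm _ by case: (thP t) => _ [].
(* A term of the presentation is only isomorphic to some [i (d t)], so [phi] is applied after
   composing with [th] and brought back along [th']. *)
have [t t' h|f fE] := inj_glue (p := p) (f := fun t => phi _ (inj p t ∘ th t) ∘ th' t).
  have [k kE] := ext_full (th' t' ∘ fmap (diagram p) h ∘ th t).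
  have E : inj p t ∘ th t = inj p t' ∘ th t' ∘ fmap i k.
    rewrite kE !compA -(compA (inj p t')) th'K compm1.
    by rewrite inj_natural.
  by rewrite E phi_nat kE !compA -[LHS]compA -!compA th'K compm1.
(* A map out of [i a] is determined on the terms of a presentation of [a], which reduces the claim
   to compact [a]. *)
exists f; suff H a (u : hom (i a) e) : compact kappa U a -> f ∘ u = phi a u.
  move=> a u; have q := pres a; apply: (image_ext (p := q)) => t.
  by rewrite -phi_nat -compA H //; exact: diagram_compact.
move=> ca; have [t [g <-]] := compact_inj p u (i_compact ca).
have [k kE] := ext_full (th' t ∘ g).
have E : inj p t ∘ g = inj p t ∘ th t ∘ fmap i k.
  by rewrite kE compA -(compA (inj p t)) th'K compm1.
by rewrite [in RHS]E phi_nat kE !compA fE.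
Qed.

(** * Compact objects over an object of the extension *)

Section Comma.
Variable e : obj Cplus.

Definition comma : category.
Proof.
refine (@Category {a : {a : obj C | compact kappa U a} & hom (i (proj1_sig a)) e}
  (fun x y => {h : @hom C (proj1_sig (projT1 x)) (proj1_sig (projT1 y)) |
               projT2 y ∘ fmap i h = projT2 x})
  (fun x => exist _ (idm _) _)
  (fun x y z g f => exist _ (proj1_sig g ∘ proj1_sig f) _) _ _ _).
- by move=> x y f; apply: sig_eq; exact: comp1m.
- by move=> x y f; apply: sig_eq; exact: compm1.
- by move=> x y z t h g f; apply: sig_eq; exact: compA.
Unshelve.
- by rewrite fmap1 compm1.
- by rewrite fmapM compA (proj2_sig g) (proj2_sig f).
Defined.

Definition comma_base : functor comma C.
Proof.
by exists (fun x : obj comma => proj1_sig (projT1 x) : obj C) (fun x y f => proj1_sig f).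
Defined.

Definition comma_mk (a : obj C) (ca : compact kappa U a) (u : hom (i a) e) : obj comma :=
  existT _ (exist _ a ca) u.

(** By compactness the maps to [e] factor through a presentation of [e], and each edge commutes at a
    later term. The resulting kappa-small graph in its shape has a cocone ending at a compact term,
    isomorphic to some [i d]; full faithfulness carries it back to [C]. *)
Lemma comma_filtered : graph_filtered kappa comma.
Proof.
move=> O M o s t p sO sM; have q := pres_plus e.
have F x : exists r (y : hom (i (comma_base (o x))) (diagram q r)),
    inj q r ∘ y = projT2 (o x).
  by apply: compact_inj; apply: i_compact; exact: (proj2_sig (projT1 (o x))).
pose r x := projT1 (cid (F x)).
pose y x : hom (i (comma_base (o x))) (diagram q (r x)) := projT1 (cid (projT2 (cid (F x)))).
have yE x : inj q (r x) ∘ y x = projT2 (o x) by exact: projT2 (cid (projT2 (cid (F x)))).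
have G m : exists (z : obj (shape q)) (u : hom (r (s m)) z) (v : hom (r (t m)) z),
    fmap (diagram q) u ∘ y (s m) = fmap (diagram q) v ∘ (y (t m) ∘ fmap i (proj1_sig (p m))).
  have cs : compact kappa Uplus (i (comma_base (o (s m)))).
    by apply: i_compact; exact: (proj2_sig (projT1 (o (s m)))).
  apply: (compact_eq kappa_regular cs (shape_small q) (shape_filtered q) (inj_colimit q)).
  have E : inj q (r (s m)) ∘ y (s m) =
      inj q (r (t m)) ∘ (y (t m) ∘ fmap i (proj1_sig (p m))).
    by rewrite compA !yE; rewrite (proj2_sig (p m)).
  exact: E.
pose z m := projT1 (cid (G m)).
pose u m : hom (r (s m)) (z m) := projT1 (cid (projT2 (cid (G m)))).
have G' m : exists v : hom (r (t m)) (z m), fmap (diagram q) (u m) ∘ y (s m) =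
    fmap (diagram q) v ∘ (y (t m) ∘ fmap i (proj1_sig (p m))).
  exact: projT2 (cid (projT2 (cid (G m)))).
pose v m := projT1 (cid (G' m)).
have uv m : fmap (diagram q) (u m) ∘ y (s m) =
    fmap (diagram q) (v m) ∘ (y (t m) ∘ fmap i (proj1_sig (p m))).
  exact: projT2 (cid (G' m)).
(* The vertex [z m] is where the edge [m] becomes commutative; it receives one arrow from each end
   of [m]. *)
pose o' (x : O + M) := match x with inl x => r x | inr m => z m end.
pose s' (m : M + M) : O + M := match m with inl m => inl (s m) | inr m => inl (t m) end.
pose t' (m : M + M) : O + M := match m with inl m => inr m | inr m => inr m end.
pose p' (m : M + M) : hom (o' (s' m)) (o' (t' m)) :=
  match m with inl m => u m | inr m => v m end.
have [c [l lE]] := filtered_graph_filtered kappa_regular (shape_filtered q) p'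
  (small_in_sum kappa_regular sO sM) (small_in_sum kappa_regular sM sM).
have [d [th [th' [cd [_ thK]]]]] := compact_lift (diagram_compact q c).
have Q x : exists k : hom (comma_base (o x)) d,
    fmap i k = th' ∘ (fmap (diagram q) (l (inl x)) ∘ y x) by exact: ext_full.
pose k x := projT1 (cid (Q x)).
have kE x : fmap i (k x) = th' ∘ (fmap (diagram q) (l (inl x)) ∘ y x).
  exact: projT2 (cid (Q x)).
pose top := comma_mk cd (inj q c ∘ th).
have kP x : projT2 top ∘ fmap i (k x) = projT2 (o x).
  change (inj q c ∘ th ∘ fmap i (k x) = projT2 (o x)).
  by rewrite kE compA -(compA _ th) thK compm1 compA inj_natural yE.
exists top, (fun x => exist _ (k x) (kP x)) => m; apply: sig_eq.
apply: ext_faithful; change (fmap i (k (t m) ∘ proj1_sig (p m)) = fmap i (k (s m))).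
have ul : l (inr m) ∘ u m = l (inl (s m)) := lE (inl m).
have vl : l (inr m) ∘ v m = l (inl (t m)) := lE (inr m).
by rewrite fmapM !kE -ul -vl !fmapM -!compA uv.
Qed.

Lemma comma_hom_small (x y : obj comma) : small_in U (hom x y).
Proof.
apply: small_in_sig; apply: small_in_El.
by have [_ [[_ _ C_hom] _ _] _ _] := i_ext; exact: C_hom.
Qed.

(* The cocone comes from the colimit in [C] of a U-small kappa-filtered
   subcategory of [comma]; [i] preserves this colimit, so it lies over [e]. *)
Lemma comma_cocone (N : Type) (a : N -> obj C) (f : forall n, hom (i (a n)) e) :
  small_in U N ->
  exists (d : obj C) (g : hom (i d) e) (h : forall n, hom (a n) d),
    (forall n, g ∘ fmap i (h n) = f n) /\
    (forall m n (w : hom (a m) (a n)), f n ∘ fmap i w = f m -> h n ∘ w = h m).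
Proof.
move=> sN.
pose p n := pres (a n).
(* The [a n] need not be compact, so they enter [comma] through the terms of their presentations. *)
pose x n t := comma_mk (diagram_compact (p n) t) (f n ∘ fmap i (inj (p n) t)).
pose B y := exists n t, x n t = y.
have sB : small_in U {y | B y}.
  pose S := {n : N & obj (shape (p n))}.
  apply: (@small_in_cover _ S _ (fun z => x (projT1 z) (projT2 z))).
    by move=> y [n [t <-]]; exists (existT _ n t).
  apply: small_in_sigT => // n; apply: small_in_El.
  by case: (shape_small (p n)).
have [P [BP sP P_filtered]] :=
  filtered_closure kappa_regular U_universe kappa_U comma_filtered comma_hom_small sB.
have sM : small_in U (mor (fullsub P)).
  by do 2!apply: (small_in_sigT U_universe) => // ?; exact: comma_hom_small.
have [J [R [[u uU Ju] [w wU Jw] Rff Rsurj]]] := @realize U (fullsub P) sP sM.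
have sJ : small U J by split; apply: (universe_sub U_universe); [exact: Ju|exact: uU|exact: Jw|exact: wU].
have fJ := filtered_transfer Rff Rsurj P_filtered.
pose Y : functor (fullsub P) C := @Functor (fullsub P) C (fun y => comma_base (proj1_sig y))
  (fun y z h => fmap comma_base h) (fun y => erefl) (fun y1 y2 y3 h1 h2 => erefl).
have [c cc] : has_colimit (Y ⊙ R) by have [_ [_ C_col _] _ _] := i_ext; exact: C_col.
have icc := i_preserves sJ fJ cc.
have [|//|l [ln lE]] := cocone_transfer c.
  by move=> b b'; exact: (proj2 (proj1 (bijectiveP _) (Rff b b'))).
have [|g gE] := @colimit_glue J Cplus (i ⊙ (Y ⊙ R)) (map_cocone i c) e
    (fun b => projT2 (proj1_sig (R b))) icc.
  by move=> b b' h; exact: (proj2_sig (fmap R h)).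
have {}gE y : g ∘ fmap i (l y) = projT2 (proj1_sig y).
  by have [b <-] := Rsurj y; rewrite lE; exact: gE.
have Px n t : P (x n t) by apply: BP; exists n, t.
pose y n t : obj (fullsub P) := exist P _ (Px n t).
(* The subcategory is full, so [l] respects every map over [e], also between presentations of
   different objects. *)
have l_comma m n s t (v : hom (diagram (p m) s) (diagram (p n) t)) :
    f n ∘ fmap i (inj (p n) t) ∘ fmap i v = f m ∘ fmap i (inj (p m) s) ->
    l (y n t) ∘ v = l (y m s).
  move=> E; exact: (ln (y m s) (y n t) (exist _ v E)).
have H n : exists h : hom (a n) (apex c), forall t, h ∘ inj (p n) t = l (y n t).
  apply: (inj_glue (p := p n)) => t t' v; apply: l_comma.
  by rewrite -compA -fmapM inj_natural.
pose h n := projT1 (cid (H n)).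
have hE n t : h n ∘ inj (p n) t = l (y n t) by exact: projT2 (cid (H n)) t.
exists (apex c), g, h; split=> [n|m n v fv].
  by apply: (image_ext (p := p n)) => t; rewrite -compA -fmapM hE; exact: (gE (y n t)).
apply: (inj_ext (p := p m)) => s.
(* Compactness turns [v] on one term into a map between terms of two presentations, to which
   [l_comma] applies. *)
have [t [v' v'E]] := compact_inj (p n) (v ∘ inj (p m) s) (diagram_compact (p m) s).
rewrite -compA -v'E compA !hE; apply: l_comma.
by rewrite -compA -fmapM v'E fmapM compA fv.
Qed.

End Comma.

End Extension.

(** * Pointwise Kan extensions *)

Lemma nat_trans_eq (C D : category) (F G : functor C D) (s t : nat_trans F G) :
  (forall a, s a = t a) -> s = t.
Proof.
case: s t => [s sn] [t tn] /= st.
have E : s = t by apply: functional_extensionality_dep.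
by case: _ / E tn {st} => tn; rewrite (Prop_irrelevance sn tn).
Qed.

Lemma nat_trans_set (C : category) (F G : functor C SET) (s t : nat_trans F G) :
  s = t -> forall a (x : El (F a)), component s a x = component t a x.
Proof. by move=> ->. Qed.

Section RanP.
Variables (A C D : setcat) (F : functor A C) (G : functor A D) (H : functor C D).
Variable eps : nat_trans (H ⊙ F) G.

Definition ran_cone (c : obj C) (d : obj D) (tau : forall a, hom c (F a) -> hom d (G a)) : Prop :=
  forall a b (f : hom a b) (x : hom c (F a)), tau b (fmap F f ∘ x) = fmap G f ∘ tau a x.

Lemma pointwise_ranP : pointwise_ran eps <->
  forall (c : obj C) (d : obj D) (tau : forall a, hom c (F a) -> hom d (G a)), ran_cone tau ->
  exists! h : hom d (H c), forall a x, eps a ∘ (fmap H x ∘ h) = tau a x.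
Proof.
split=> [eps_ran c d tau tau_nat|eps_ran c d].
  have [inj surj] := proj1 (bijectiveP _) (eps_ran c d).
  have tn (a b : obj A) (f : hom a b) : @comp SET _ _ _ (tau b) (fmap (homf c ⊙ F) f) =
      @comp SET _ _ _ (fmap (homf d ⊙ G) f) (tau a).
    by apply/funext => x; exact: tau_nat.
  have [h hE] := surj (@NatTrans A SET (homf c ⊙ F) (homf d ⊙ G) tau tn).
  exists h; split=> [a x|h' h'E].
    exact: (nat_trans_set hE x).
  apply: inj; rewrite hE; apply: nat_trans_eq => a; apply/funext => x.
  exact: (esym (h'E a x)).
apply/bijectiveP; split=> [h h' E|tau].
  have tn : ran_cone (ran_map eps h) by move=> a b f x; exact: (congr1 (@^~ x) (naturality (ran_map eps h) f)).
  have [h0 [_ u]] := eps_ran c d _ tn.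
  rewrite -(u h) // -(u h') // => a x.
  exact: (nat_trans_set (esym E) x).
have tn : ran_cone (component tau) by move=> a b f x; exact: (congr1 (@^~ x) (naturality tau f)).
have [h [hE _]] := eps_ran c d _ tn.
by exists h; apply: nat_trans_eq => a; apply/funext => x; exact: hE.
Qed.

End RanP.

Section LanP.
Variables (A C D : setcat) (F : functor A C) (G : functor A D) (H : functor C D).
Variable eta : nat_trans G (H ⊙ F).

Definition lan_cocone (c : obj C) (d : obj D) (tau : forall a, hom (F a) c -> hom (G a) d) : Prop :=
  forall a b (f : hom a b) (x : hom (F b) c), tau a (x ∘ fmap F f) = tau b x ∘ fmap G f.

Lemma pointwise_lanP : pointwise_lan eta <->
  forall (c : obj C) (d : obj D) (tau : forall a, hom (F a) c -> hom (G a) d), lan_cocone tau ->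
  exists! h : hom (H c) d, forall a x, h ∘ fmap H x ∘ eta a = tau a x.
Proof.
split=> [eta_lan c d tau tau_nat|eta_lan c d].
  have [inj surj] := proj1 (bijectiveP _) (eta_lan c d).
  have tn (a b : obj (op A)) (f : @hom (op A) a b) :
      @comp SET _ _ _ (tau b) (fmap (homf (C := op C) c ⊙ fop F) f) =
      @comp SET _ _ _ (fmap (homf (C := op D) d ⊙ fop G) f) (tau a).
    by apply/funext => x; exact: tau_nat.
  have [h hE] := surj (@NatTrans (op A) SET (homf (C := op C) c ⊙ fop F)
    (homf (C := op D) d ⊙ fop G) tau tn).
  exists h; split=> [a x|h' h'E].
    exact: (nat_trans_set hE x).
  apply: inj; rewrite hE; apply: nat_trans_eq => a; apply/funext => x.
  exact: (esym (h'E a x)).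
apply/bijectiveP; split=> [h h' E|tau].
  have tn : lan_cocone (lan_map eta h) by move=> a b f x; exact: (congr1 (@^~ x) (naturality (lan_map eta h) f)).
  have [h0 [_ u]] := eta_lan c d _ tn.
  rewrite -(u h) // -(u h') // => a x.
  exact: (nat_trans_set (esym E) x).
have tn : lan_cocone (component tau) by move=> a b f x; exact: (congr1 (@^~ x) (naturality tau f)).
have [h [hE _]] := eta_lan c d _ tn.
by exists h; apply: nat_trans_eq => a; apply/funext => x; exact: hE.
Qed.

End LanP.

(** * Pasting with the extension along [i] *)

Section Paste.
Variables (A C D Cplus Dplus : setcat) (F : functor A C) (G : functor A D).
Variables (i : functor C Cplus) (j : functor D Dplus).
Variables (H : functor C D) (Hplus : functor Cplus Dplus).

(** Restricting [tau] along a fixed [y : c -> i b] gives a cone for the first extension at [b],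
    hence a map [s b y]; these maps form a cone for the second extension. *)
Lemma ran_paste_pointwise (eps : nat_trans (H ⊙ F) G)
    (epsplus : nat_trans (Hplus ⊙ i) (j ⊙ H)) :
  pointwise_ran (ran_whisker j eps) -> pointwise_ran epsplus ->
  pointwise_ran (ran_paste epsplus eps).
Proof.
move=> /pointwise_ranP ran /pointwise_ranP ranplus; apply/pointwise_ranP => c d tau tau_nat.
have lift b (y : hom c (i b)) : exists! s : hom d (j (H b)),
    forall a (x : hom b (F a)), fmap j (eps a) ∘ (fmap j (fmap H x) ∘ s) = tau a (fmap i x ∘ y).
  apply: (ran b d (fun a x => tau a (fmap i x ∘ y))) => a a' f x.
  by rewrite fmapM -compA; exact: tau_nat.
pose s b (y : hom c (i b)) := projT1 (cid (lift b y)).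
have sE b (y : hom c (i b)) a (x : hom b (F a)) :
    fmap j (eps a) ∘ (fmap j (fmap H x) ∘ s b y) = tau a (fmap i x ∘ y).
  by have [+ _] := projT2 (cid (lift b y)); apply.
have s_unique b (y : hom c (i b)) (r : hom d (j (H b))) :
    (forall a (x : hom b (F a)),
       fmap j (eps a) ∘ (fmap j (fmap H x) ∘ r) = tau a (fmap i x ∘ y)) -> s b y = r.
  by have [_] := projT2 (cid (lift b y)); apply.
have [|h [hE h_unique]] := ranplus c d s.
  move=> b b' f y; apply: s_unique => a x.
  change (fmap j (eps a) ∘ (fmap j (fmap H x) ∘ (fmap j (fmap H f) ∘ s b y)) =
          tau a (fmap i x ∘ (fmap i f ∘ y))).
  by rewrite (compA (fmap j (fmap H x))) -!fmapM sE fmapM compA.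
exists h; split=> [a x|h' h'E].
  change (fmap j (eps a) ∘ epsplus (F a) ∘ (fmap Hplus x ∘ h) = tau a x).
  (* Yoneda: the value of [tau] at [x] is read off at the identity of [F a]. *)
  have := sE _ x a (idm _); rewrite !fmap1 !comp1m => <-.
  by rewrite -compA hE.
apply: h_unique => b y; symmetry; apply: s_unique => a x.
have N : epsplus (F a) ∘ fmap Hplus (fmap i x) = fmap j (fmap H x) ∘ epsplus b.
  exact: naturality epsplus _ _ x.
rewrite -h'E; change (fmap j (eps a) ∘ (fmap j (fmap H x) ∘ (epsplus b ∘ (fmap Hplus y ∘ h'))) =
  fmap j (eps a) ∘ epsplus (F a) ∘ (fmap Hplus (fmap i x ∘ y) ∘ h')).
by rewrite fmapM -!compA (compA (epsplus (F a))) N -!compA.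
Qed.

Lemma lan_paste_pointwise (eta : nat_trans G (H ⊙ F))
    (etaplus : nat_trans (j ⊙ H) (Hplus ⊙ i)) :
  pointwise_lan (lan_whisker j eta) -> pointwise_lan etaplus ->
  pointwise_lan (lan_paste etaplus eta).
Proof.
move=> /pointwise_lanP lan /pointwise_lanP lanplus; apply/pointwise_lanP => c d tau tau_nat.
have ext b (y : hom (i b) c) : exists! s : hom (j (H b)) d,
    forall a (x : hom (F a) b), s ∘ fmap j (fmap H x) ∘ fmap j (eta a) = tau a (y ∘ fmap i x).
  apply: (lan b d (fun a x => tau a (y ∘ fmap i x))) => a a' f x.
  by rewrite fmapM compA; exact: tau_nat.
pose s b (y : hom (i b) c) := projT1 (cid (ext b y)).
have sE b (y : hom (i b) c) a (x : hom (F a) b) :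
    s b y ∘ fmap j (fmap H x) ∘ fmap j (eta a) = tau a (y ∘ fmap i x).
  by have [+ _] := projT2 (cid (ext b y)); apply.
have s_unique b (y : hom (i b) c) (r : hom (j (H b)) d) :
    (forall a (x : hom (F a) b),
       r ∘ fmap j (fmap H x) ∘ fmap j (eta a) = tau a (y ∘ fmap i x)) -> s b y = r.
  by have [_] := projT2 (cid (ext b y)); apply.
have [|h [hE h_unique]] := lanplus c d s.
  move=> b b' f y; apply: s_unique => a x.
  change (s b' y ∘ fmap j (fmap H f) ∘ fmap j (fmap H x) ∘ fmap j (eta a) =
          tau a (y ∘ fmap i f ∘ fmap i x)).
  by rewrite -(compA (s b' y)) -!fmapM sE fmapM compA.
exists h; split=> [a x|h' h'E].
  change (h ∘ fmap Hplus x ∘ (etaplus (F a) ∘ fmap j (eta a)) = tau a x).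
  have := sE _ x a (idm _); rewrite !fmap1 !compm1 => <-.
  by rewrite compA hE.
apply: h_unique => b y; symmetry; apply: s_unique => a x.
have N : etaplus b ∘ fmap j (fmap H x) = fmap Hplus (fmap i x) ∘ etaplus (F a).
  exact: naturality etaplus _ _ x.
rewrite -h'E; change (h' ∘ fmap Hplus y ∘ etaplus b ∘ fmap j (fmap H x) ∘ fmap j (eta a) =
  h' ∘ fmap Hplus (y ∘ fmap i x) ∘ (etaplus (F a) ∘ fmap j (eta a))).
by rewrite fmapM -!compA (compA (etaplus b)) N -!compA.
Qed.

End Paste.

(** * Composing Kan extensions with [j] *)

Section Whisker.
Variables (lambda U Uplus : V).
Hypotheses (lambda_regular : regular_cardinal lambda) (lambda_U : lambda ∈ U).
Hypotheses (U_universe : universe U) (Uplus_universe : universe Uplus) (U_Uplus : U ∈ Uplus).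
Variables (A C D Dplus : setcat) (F : functor A C) (G : functor A D) (H : functor C D).
Variable (j : functor D Dplus).
Hypothesis (j_ext : accessible_extension lambda U Uplus j).

(** After composition with [u : j d -> e], the components of [tau] run between objects in the image
    of [j], so they come from a cone in [D]. Its factorization through [H c] is natural in [d] and
    [u], and density applies. *)
Lemma ran_whisker_pointwise (eps : nat_trans (H ⊙ F) G) :
  pointwise_ran eps -> pointwise_ran (ran_whisker j eps).
Proof.
move=> /pointwise_ranP ran; apply/pointwise_ranP => c e tau tau_nat.
have faithful a b := @ext_faithful _ _ _ lambda_regular Uplus_universe U_Uplus _ _ _ j_ext a b.
have full a b := @ext_full _ _ _ lambda_regular Uplus_universe U_Uplus _ _ _ j_ext a b.
have epi e1 e2 := @ext_jointly_epi _ _ _ _ _ _ j_ext e1 e2.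
have unique d (v v' : hom d (H c)) :
    (forall a (x : hom c (F a)), eps a ∘ (fmap H x ∘ v) = eps a ∘ (fmap H x ∘ v')) -> v = v'.
  move=> E; have [|w [_ wu]] := ran c d (fun a x => eps a ∘ (fmap H x ∘ v)).
    move=> a b f x; have N : eps b ∘ fmap H (fmap F f) = fmap G f ∘ eps a.
      exact: naturality eps _ _ f.
    by rewrite fmapM -(compA (fmap H (fmap F f))) (compA (eps b)) N -compA.
  by rewrite -(wu v) //; apply: wu => a x; rewrite E.
have lift d (u : hom (j d) e) : exists v : hom d (H c),
    forall a (x : hom c (F a)), fmap j (eps a ∘ (fmap H x ∘ v)) = tau a x ∘ u.
  have Q a (x : hom c (F a)) : exists y, fmap j y = tau a x ∘ u by exact: full.
  pose y a x := projT1 (cid (Q a x)).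
  have yE a x : fmap j (y a x) = tau a x ∘ u by exact: projT2 (cid (Q a x)).
  have [|v [vE _]] := ran c d y.
    move=> a b f x; apply: faithful; rewrite yE fmapM yE compA.
    by congr (_ ∘ _); exact: tau_nat.
  by exists v => a x; rewrite vE yE.
pose v d u := projT1 (cid (lift d u)).
have vE d u a x : fmap j (eps a ∘ (fmap H x ∘ v d u)) = tau a x ∘ u.
  exact: (projT2 (cid (lift d u)) a x).
have [d d' k u|h hE] := ext_dense lambda_regular Uplus_universe U_Uplus j_ext
    (e := e) (e' := j (H c)) (phi := fun d u => fmap j (v d u)).
  rewrite -fmapM; congr (fmap j _); apply: unique => a x; apply: faithful.
  by rewrite vE !compA fmapM -!compA vE compA.
have tauE a x : fmap j (eps a) ∘ (fmap j (fmap H x) ∘ h) = tau a x.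
  by apply: epi => d u; rewrite -!compA hE -!fmapM vE.
exists h; split=> [a x|h' h'E]; first exact: tauE.
apply: epi => d u; have [w wE] := full _ _ (h' ∘ u); rewrite hE -wE.
congr (fmap j _); apply: unique => a x; apply: faithful.
rewrite vE !fmapM wE !compA; congr (_ ∘ _).
by rewrite -compA; exact: esym (h'E a x).
Qed.

(** The components of [tau] are indexed by pairs of an object of [A] and a map from [F a] to [c], a
    U-small family, so [comma_cocone] lifts them all at once to a cocone in [D]. *)
Lemma lan_whisker_pointwise (eta : nat_trans G (H ⊙ F)) : small U A -> locally_small U C ->
  pointwise_lan eta -> pointwise_lan (lan_whisker j eta).
Proof.
move=> [A_small _] [_ _ C_hom] /pointwise_lanP lan; apply/pointwise_lanP => c e tau tau_nat.
have cocones := @comma_cocone _ _ _ lambda_regular lambda_U U_universe Uplus_universe U_Uplus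
  _ _ _ j_ext e.
pose N : Type := {a : El (sob A) & El (shom C (F a) c)}.
have sN : small_in U N.
  by apply: small_in_sigT => // [|a]; apply: small_in_El => //; exact: C_hom.
have unique d (v v' : hom (H c) d) :
    (forall a (x : hom (F a) c), v ∘ fmap H x ∘ eta a = v' ∘ fmap H x ∘ eta a) -> v = v'.
  move=> E; have [|w [_ wu]] := lan c d (fun a x => v ∘ fmap H x ∘ eta a).
    move=> a b f x; have Nf : eta b ∘ fmap G f = fmap H (fmap F f) ∘ eta a.
      exact: naturality eta _ _ f.
    by rewrite fmapM -!compA Nf.
  by rewrite -(wu v) //; apply: wu => a x; rewrite E.
have [d [g [h [hE h_comp]]]] := cocones N (fun n => G (projT1 n)) (fun n => tau _ (projT2 n)) sN.
have [|v [vE _]] := lan c d (fun a x => h (existT _ a x)).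
  move=> a b f x; symmetry; apply: (h_comp (existT _ a _) (existT _ b x)).
  by symmetry; exact: tau_nat.
exists (g ∘ fmap j v); split=> [a x|p pE].
  change (g ∘ fmap j v ∘ fmap j (fmap H x) ∘ fmap j (eta a) = tau a x).
  by rewrite -!compA -!fmapM compA vE (hE (existT _ a x)).
pose q := g ∘ fmap j v.
have qE a (x : hom (F a) c) : q ∘ fmap j (fmap H x ∘ eta a) = tau a x.
  by rewrite /q -compA -fmapM compA vE (hE (existT _ a x)).
have {}pE a (x : hom (F a) c) : p ∘ fmap j (fmap H x ∘ eta a) = tau a x.
  by rewrite fmapM compA; exact: pE.
(* The competing maps [p] and [q] join the family as two copies of [H c] over [e]; their lifts agree
   on the cocone, hence coincide by uniqueness in [D]. *)
pose N' : Type := (bool + N)%type.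
pose a' (n : N') := match n with inl _ => H c | inr n => G (projT1 n) end.
pose f' (n : N') : hom (j (a' n)) e :=
  match n with inl b => if b then p else q | inr n => tau _ (projT2 n) end.
have sN' : small_in U N'.
  by apply: small_in_universe_sum => //; exact: small_in_universe_bool.
have [d' [g' [h' [h'E h'_comp]]]] := cocones N' a' f' sN'.
suff E : h' (inl true) = h' (inl false).
  have hp : g' ∘ fmap j (h' (inl true)) = p := h'E (inl true).
  have hq : g' ∘ fmap j (h' (inl false)) = q := h'E (inl false).
  by rewrite -hp E hq.
apply: unique => a x; rewrite -!compA.
rewrite (h'_comp (inr (existT _ a x)) (inl true)); last exact: pE.
by rewrite (h'_comp (inr (existT _ a x)) (inl false)); last exact: qE.
Qed.

End Whisker.

Theorem corollary3p15
  (U Uplus kappa lambda : V)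
  (U_universe : universe U) (Uplus_universe : universe Uplus)
  (U_Uplus : U ∈ Uplus)
  (kappa_regular : regular_cardinal kappa) (kappa_U : kappa ∈ U)
  (lambda_regular : regular_cardinal lambda) (lambda_U : lambda ∈ U)
  (A C D Cplus Dplus : setcat)
  (C_lp : locally_presentable kappa U C)
  (D_lp : locally_presentable lambda U D)
  (Cplus_lp : locally_presentable kappa Uplus Cplus)
  (Dplus_lp : locally_presentable lambda Uplus Dplus)
  (F : functor A C) (G : functor A D)
  (i : functor C Cplus) (i_ext : accessible_extension kappa U Uplus i)
  (j : functor D Dplus) (j_ext : accessible_extension lambda U Uplus j)
  (H : functor C D) (Hplus : functor Cplus Dplus) :
  ((exists U' : V, pre_universe U' /\ small U' A) ->
   forall eps : nat_trans (H ⊙ F) G, pointwise_ran eps ->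
     pointwise_ran (ran_whisker j eps) /\
     forall epsplus : nat_trans (Hplus ⊙ i) (j ⊙ H), pointwise_ran epsplus ->
       pointwise_ran (ran_paste epsplus eps)) /\
  (small U A ->
   forall eta : nat_trans G (H ⊙ F), pointwise_lan eta ->
     pointwise_lan (lan_whisker j eta) /\
     forall etaplus : nat_trans (j ⊙ H) (Hplus ⊙ i), pointwise_lan etaplus ->
       pointwise_lan (lan_paste etaplus eta)).
Proof.
split=> [_ eps eps_ran|A_small eta eta_lan].
  have jeps_ran := ran_whisker_pointwise lambda_regular Uplus_universe U_Uplus j_ext eps_ran.
  by split=> // epsplus; exact: ran_paste_pointwise.
have C_locally_small : locally_small U C by case: C_lp => -[].
have jeta_lan := lan_whisker_pointwise lambda_regular lambda_U U_universe Uplus_universe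
  U_Uplus j_ext A_small C_locally_small eta_lan.
by split=> // etaplus; exact: lan_paste_pointwise.
Qed.
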